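(* Let $n\ge 2$ and let $\mathfrak{B}_n$ be the group of signed permutations of $\{\pm1,\dots,\pm n\}$ in window notation $\pi=\pi_1\cdots\pi_n$. Let $\mathrm{negs}(\pi)=|\{i:\pi_i<0\}|$ and $\mathfrak{D}_n=\{\pi\in\mathfrak{B}_n:\mathrm{negs}(\pi)\text{ even}\}$. Let $\mathrm{inv}_D(\pi)=|\{1\le i<j\le n:\pi_i>\pi_j\}|+|\{1\le i<j\le n:-\pi_i>\pi_j\}|$, and $\mathfrak{D}_n^{+}=\{\pi\in\mathfrak{D}_n:\mathrm{inv}_D(\pi)\text{ even}\}$, $\mathfrak{D}_n^{-}=\{\pi\in\mathfrak{D}_n:\mathrm{inv}_D(\pi)\text{ odd}\}$. For $\pi\in\mathfrak{D}_n$ set $\pi_0=-\pi_2$ and $\mathrm{des}_D(\pi)=|\{i\in\{0,\dots,n-1\}:\pi_i>\pi_{i+1}\}|$, and let $D_n^{\pm}(t)=\sum_{\pi\in\mathfrak{D}_n^{\pm}}t^{\mathrm{des}_D(\pi)}$. Then the distribution of the coefficients of $D_n^{+}(t)$ and of $D_n^{-}(t)$ is asymptotically normal as $n\to\infty$. Over $\mathfrak{D}_n^{+}$ and over $\mathfrak{D}_n^{-}$ (uniform distribution), the random variable $\mathrm{des}_D$ has mean $n/2$ when $n\ge 3$ and variance $(n+2)/12$ when $n\ge 4$.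
   Context: To a polynomial $P(t)=\sum_k p_k t^k$ with nonnegative coefficients and $P(1)>0$ associate the random variable $X$ with $\Pr(X=k)=p_k/P(1)$. A sequence of such polynomials $P_n(t)=\sum_k p_{n,k}t^k$ has asymptotically normal coefficient distribution if, with $\mu_n,\sigma_n^2$ the mean and variance of the associated random variable, $\lim_{n\to\infty}\sup_{x\in\mathbb{R}}\left|\sum_{k\le\lfloor x\sigma_n+\mu_n\rfloor}\frac{p_{n,k}}{P_n(1)}-\Phi(x)\right|=0$, where $\Phi$ is the standard normal cumulative distribution function. *)

(* Defs.v *)
From HB Require Import structures.
From mathcomp Require Import all_boot all_order all_fingroup all_algebra.
From mathcomp Require Import all_classical all_reals all_analysis.

Set Implicit Arguments.
Unset Strict Implicit.
Unset Printing Implicit Defensive.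

Import Order.TTheory GRing.Theory Num.Theory.
Import numFieldNormedType.Exports.

Local Open Scope ring_scope.

(* The letters 1, ..., n, -1, ..., -n: the pair (i, b) with i : 'I_n stands   *)
(* for i + 1 if b = false and for -(i + 1) if b = true.                       *)
Definition letter (n : nat) : finType := ('I_n * bool)%type.

Definition letter_opp (n : nat) (x : letter n) : letter n := (x.1, ~~ x.2).

Definition letter_val (n : nat) (x : letter n) : int :=
  if x.2 then - (x.1.+1)%:Z else (x.1.+1)%:Z.

Definition signed_perms (n : nat) : {set {perm letter n}} :=
  [set s : {perm letter n} |
    [forall x, s (letter_opp x) == letter_opp (s x)]].

Lemma signed_perms_group_set (n : nat) : group_set (signed_perms n).
Proof.
apply/group_setP; split=> [|s u]; first by rewrite inE; apply/forallP=> x; rewrite !perm1.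
rewrite !inE => /forallP hs /forallP hu; apply/forallP=> x.
by rewrite !permM (eqP (hs x)) (eqP (hu (s x))).
Qed.

Canonical signed_perms_group (n : nat) := Group (signed_perms_group_set n).

Definition window (n : nat) (s : {perm letter n}) : seq int :=
  [seq letter_val (s (i, false)) | i <- enum 'I_n].

(* The entry pi_i with the 1-based indices of window notation, 1 <= i <= n,   *)
(* extended by the type D convention pi_0 = - pi_2 (n >= 2).                  *)
Definition entry (n : nat) (s : {perm letter n}) (i : nat) : int :=
  if i is j.+1 then (window s)`_j else - (window s)`_1.

Definition negs (n : nat) (s : {perm letter n}) : nat :=
  #|[set i : 'I_n | entry s i.+1 < 0]|.

Definition even_signed_perms (n : nat) : {set {perm letter n}} :=
  [set s in signed_perms n | ~~ odd (negs s)].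

Definition invD (n : nat) (s : {perm letter n}) : nat :=
  (#|[set p : 'I_n * 'I_n |
       (p.1 < p.2)%N && (entry s p.1.+1 > entry s p.2.+1)%R]| +
   #|[set p : 'I_n * 'I_n |
       (p.1 < p.2)%N && (- entry s p.1.+1 > entry s p.2.+1)%R]|)%N.

Definition Dplus (n : nat) : {set {perm letter n}} :=
  [set s in even_signed_perms n | ~~ odd (invD s)].

Definition Dminus (n : nat) : {set {perm letter n}} :=
  [set s in even_signed_perms n | odd (invD s)].

Definition desD (n : nat) (s : {perm letter n}) : nat :=
  #|[set i : 'I_n | entry s i > entry s i.+1]|.

Definition desD_poly (R : realType) (n : nat) (A : {set {perm letter n}}) :
  {poly R} := \sum_(s in A) 'X^(desD s).

Definition unif_mean (R : realType) (T : finType) (A : {set T}) (f : T -> R) : R :=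
  (\sum_(x in A) f x) / #|A|%:R.

Definition unif_var (R : realType) (T : finType) (A : {set T}) (f : T -> R) : R :=
  unif_mean A (fun x => (f x - unif_mean A f) ^+ 2).

Definition coef_prob (R : realType) (P : {poly R}) (k : nat) : R :=
  P`_k / P.[1].

Definition coef_mean (R : realType) (P : {poly R}) : R :=
  \sum_(k < size P) k%:R * coef_prob P k.

Definition coef_var (R : realType) (P : {poly R}) : R :=
  \sum_(k < size P) (k%:R - coef_mean P) ^+ 2 * coef_prob P k.

Definition std_normal_cdf (R : realType) (x : R) : R :=
  fine (normal_prob 0 1 `]-oo, x]%classic).

Definition coef_cdf_dist (R : realType) (P : {poly R}) (x : R) : R :=
  `| (\sum_(k < size P |
        (k%:Z <= Num.floor (x * Num.sqrt (coef_var P) + coef_mean P))%R)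
        coef_prob P k) - std_normal_cdf x |.

Local Open Scope classical_set_scope.

Definition asymptotically_normal (R : realType) (P : nat -> {poly R}) : Prop :=
  ereal_sup (range (fun x : R => (coef_cdf_dist (P n) x)%:E))
    @[n --> \oo] --> 0%E.

(* Main.v *)
Require Import Defs.
From HB Require Import structures.
From mathcomp Require Import all_boot all_order all_fingroup all_algebra.
From mathcomp Require Import all_classical all_reals all_analysis.
From mathcomp Require Import ring lra zify.

(* Negating two letters of a word, or applying an even permutation to its
   positions, preserves both D_n^+ and D_n^-: the parity of inv_D is that of
   the underlying unsigned permutation. Writing xi_i for the indicator of a
   descent at i minus 1/2, negating the letters i and i + 1 changes the sign of
   xi_i and fixes xi_j for |i - j| >= 2, so xi_i has mean 0 given the distant
   xi_j. Negations and 3-cycles of positions give E(xi_i xi_(i+1)) = -1/12 and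
   make the products xi_i xi_(i+1) uncorrelated at distance >= 3. This yields
   the mean and the variance, and Stein's method for locally dependent
   summands gives asymptotic normality, uniformly in the argument of the
   distribution function; xi_0 is a negligible perturbation. *)

Set Implicit Arguments.
Unset Strict Implicit.
Unset Printing Implicit Defensive.

Import Order.TTheory GRing.Theory Num.Theory.
Import numFieldNormedType.Exports.

Local Open Scope ring_scope.

(** The two parity conditions tie all letters of a word together. What takes the place of
    independence of distant blocks is a pair of consequences of symmetry: each [xi_j] has mean zero
    against any function of the sum of its non-neighbours, and the sum of the centred products of
    neighbours has a second moment of order n. Both come from bijections of a parity class that move
    or negate only a few letters. The sum without [xi_0] has variance (n + 1) / 12, not (n + 2) /
    12. Normalisation by the full variance is imposed from the start, and the missing 1 / 12 is
    counted as an error term. The indicator of a half-line is replaced by a ramp of width [d] on the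
    scale of [Phi], at a cost of order [d]. The ramp has slope [1 / d], so the error in Stein's
    method is of order [(1 + 1 / d) / sigma]; taking [d] to be the inverse square root of [sigma]
    sends both to zero. *)

Section real_derivatives.
Context {R : realType}.
Implicit Types (f df : R -> R) (x y d C : R).
Local Open Scope classical_set_scope.

(** The slope function, completed by [d] at [x], differs from [d] by at most [|C| * |y - x|], hence
    is continuous there. The criterion suits quadratic and piecewise quadratic functions, kinks of
    the derivative included. *)
Lemma is_derive_of_quadratic_bound f x d C :
  (forall y, `|f y - f x - d * (y - x)| <= C * (y - x) ^+ 2) ->
  is_derive x 1 f d.
Proof.
move=> fC; apply/is_derive1_caratheodory.
exists (fun y => if y == x then d else (f y - f x) / (y - x)); split.
- move=> y; case: eqVneq => [->|yx]; first by rewrite !subrr mulr0.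
  by rewrite divfK// subr_eq0.
- have C1 : 0 < `|C| + 1 by rewrite ltr_wpDl.
  have nby (r : R) : 0 < r -> \forall y \near x, `|x - y| < r.
    by move=> r0; exact: nbhsx_ballx.
  apply/cvgrPdist_le => /= e e0; rewrite eqxx.
  apply: filterS (nby _ (divr_gt0 e0 C1)) => y xy.
  case: eqVneq => [_|yx]; first by rewrite subrr normr0 ltW.
  have yx0 : 0 < `|y - x| by rewrite normr_gt0 subr_eq0.
  rewrite distrC -(ler_pM2r yx0) -normrM mulrBl divfK ?subr_eq0//.
  apply: (le_trans (fC y)); rewrite -(ger0_norm (sqr_ge0 _)) normrX expr2 mulrA.
  rewrite ler_pM2r//; apply: (@le_trans _ _ ((`|C| + 1) * `|y - x|)).
    by rewrite ler_wpM2r// (le_trans (ler_norm C))// lerDl.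
  by rewrite mulrC -ler_pdivlMr// distrC ltW.
- by rewrite eqxx.
Qed.

Lemma mean_value f df :
  (forall x, is_derive x 1 f (df x)) ->
  forall x y, x < y -> exists2 c, x < c < y & f y - f x = df c * (y - x).
Proof.
move=> fdf x y xy.
have cf : {within `[x, y], continuous f}.
  apply: continuous_subspaceT => z; apply: differentiable_continuous.
  by apply/derivable1_diffP; have [] := fdf z.
have [c] := MVT xy (fun z _ => fdf z) cf.
by rewrite in_itv/= => xcy ->; exists c.
Qed.

Lemma mean_value_dist f df :
  (forall x, is_derive x 1 f (df x)) ->
  forall x y, exists2 c, `|c - x| <= `|y - x| & f y - f x = df c * (y - x).
Proof.
move=> fdf x y; have [xy|yx|<-] := ltgtP x y.
- have [c /andP[xc cy] ->] := mean_value fdf xy; exists c => //.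
  by rewrite !ger0_norm; lra.
- have [c /andP[yc cx] E] := mean_value fdf yx; exists c; last by lra.
  by rewrite !ler0_norm; lra.
- by exists x; rewrite ?subrr ?mulr0.
Qed.

Lemma lipschitz_of_derive f df C :
  (forall x, is_derive x 1 f (df x)) -> (forall x, `|df x| <= C) ->
  forall x y, `|f y - f x| <= C * `|y - x|.
Proof.
move=> fdf dfC x y; have [c _ ->] := mean_value_dist fdf x y.
by rewrite normrM ler_wpM2r.
Qed.

End real_derivatives.

(** * The standard normal distribution function: limits, derivative, tails *)

Section normal_cdf.
Context {R : realType}.
Implicit Types x y e : R.

Local Notation mu := lebesgue_measure.
Local Notation Phi := (@std_normal_cdf R).
Local Notation phi := (@normal_pdf R 0 1).

(** Under the standard normal law the identity is a random variable whose [cdf] is [Phi];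
    monotonicity and the limits at infinity are inherited through it. *)
Let idR : measurableTypeR R -> R := idfun.

#[local] HB.instance Definition _ :=
  @isMeasurableFun.Build _ _ _ _ idR (@measurable_id _ _ setT).

Let idRV : {RV (normal_prob (0 : R) 1) >-> R} := idR.

Let cdfE x : cdf idRV x = (Phi x)%:E.
Proof. by rewrite /std_normal_cdf fineK ?fin_num_measure. Qed.

Lemma std_normal_pdfE x :
  phi x = normal_peak 1 * expR (- x ^+ 2 / 2).
Proof.
by rewrite normal_pdfE ?oner_eq0// /normal_fun subr0 expr1n.
Qed.

Lemma std_normal_pdf_gt0 x : 0 < phi x.
Proof.
by rewrite std_normal_pdfE mulr_gt0 ?expR_gt0 ?normal_peak_gt0 ?oner_eq0.
Qed.

Lemma std_normal_cdf_ge0 x : 0 <= Phi x.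
Proof. by rewrite -lee_fin -cdfE cdf_ge0. Qed.

Lemma std_normal_cdf_le1 x : Phi x <= 1.
Proof. by rewrite -lee_fin -cdfE cdf_le1. Qed.

Lemma std_normal_cdf_nondecreasing : {homo Phi : x y / x <= y}.
Proof. by move=> x y xy; rewrite -lee_fin -!cdfE cdf_nondecreasing. Qed.

Local Open Scope classical_set_scope.

Let cvg_PhiNy : Phi x @[x --> -oo] --> (0 : R).
Proof.
have := @cvg_cdfNy0 _ _ R _ idRV.
have -> : cdf idRV = EFin \o Phi by apply/funext => x; exact: cdfE.
by move/fine_cvg.
Qed.

Let cvg_Phiy : Phi x @[x --> +oo] --> (1 : R).
Proof.
have := @cvg_cdfy1 _ _ R _ idRV.
have -> : cdf idRV = EFin \o Phi by apply/funext => x; exact: cdfE.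
by move/fine_cvg.
Qed.

Lemma std_normal_cdf_left_tail x e : 0 < e -> exists2 m, m < x & Phi m < e.
Proof.
move=> e0.
have lte : \forall m \near -oo, Phi m < e by move/cvgr_lt: cvg_PhiNy; apply.
have ltx : \forall m \near -oo, m < x by exact: (nbhs_ninfty_lt (num_real x)).
by have [m [? ?]] := filter_ex (filterI ltx lte); exists m.
Qed.

Lemma std_normal_cdf_right_tail x e :
  0 < e -> exists2 m, x < m & 1 - e < Phi m.
Proof.
move=> e0.
have lte : \forall m \near +oo, 1 - e < Phi m.
  by move/cvgr_gt: cvg_Phiy; apply; rewrite ltrBlDr ltrDl.
have ltx : \forall m \near +oo, x < m by exact: (nbhs_pinfty_gt (num_real x)).
by have [m [? ?]] := filter_ex (filterI ltx lte); exists m.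
Qed.

Lemma is_derive_std_normal_cdf x : is_derive x 1 Phi (phi x).
Proof.
have intphi : mu.-integrable [set` Interval -oo%O (BRight (x + 1))] (EFin \o phi).
  by apply: (integrableS _ _ (subsetT _)) => //; exact: integrable_normal_pdf.
(* The right end [x + 1] only serves to make [x] an interior point. *)
have [] := @continuous_FTC1 R phi -oo%O x (x + 1) _ intphi.
- by rewrite ltrDl.
- by rewrite ltNyr.
- by apply: continuous_normal_pdf; rewrite oner_eq0.
have -> : (fun y => Rintegral mu [set` Interval -oo%O (BRight y)] phi) = Phi.
  by apply/funext.
by rewrite derive1E => dPhi <-; exact/derivableP.
Qed.

Lemma is_derive_std_normal_pdf x : is_derive x 1 phi (- x * phi x).
Proof.
have dq : is_derive x 1 (fun y : R => - y ^+ 2 / 2) (- x).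
  apply: (is_derive_of_quadratic_bound (C := 2^-1)) => y.
  rewrite (_ : _ - _ - _ = - (2^-1 * (y - x) ^+ 2)); last by field.
  by rewrite normrN ger0_norm// mulr_ge0 ?sqr_ge0 ?invr_ge0.
have -> : phi = normal_peak 1 \*: (expR \o (fun y : R => - y ^+ 2 / 2)).
  by apply/funext => y; exact: std_normal_pdfE.
by apply: is_derive_eq; rewrite /GRing.scale/= mulrA mulrC.
Qed.

(* Mills' inequality, by comparing the derivatives of [Phi] and [phi / |x|]. *)
Lemma std_normal_cdf_mills x : x < 0 -> - x * Phi x <= phi x.
Proof.
move=> x0; apply/ler_addgt0Pr => e e0; have Nx0 : 0 < - x by rewrite oppr_gt0.
have [m mx Phim] := std_normal_cdf_left_tail x (divr_gt0 e0 Nx0).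
have [|c /andP[mc cx] gE] :=
    mean_value (f := fun y => - x * Phi y - phi y) (df := fun y => - x * phi y - - y * phi y) _ mx.
  move=> y; have := is_derive_std_normal_cdf y; have := is_derive_std_normal_pdf y => dp dP.
  exact: (is_deriveB (is_deriveZ _ _) _).
have := std_normal_pdf_gt0 c; have := std_normal_pdf_gt0 m => phim phic.
have : - x * Phi m < e by rewrite mulrC -ltr_pdivlMr ?oppr_gt0.
have : (x - c) * phi c * (x - m) >= 0 by rewrite !mulr_ge0// ?subr_ge0 ltW.
lra.
Qed.

Lemma std_normal_ccdf_mills x : 0 < x -> x * (1 - Phi x) <= phi x.
Proof.
move=> x0; apply/ler_addgt0Pr => e e0.
(* A far point [m] with [x * (1 - Phi m) < e] stands in for the limit at infinity. *)
have [m mx Phim] := std_normal_cdf_right_tail x (divr_gt0 e0 x0).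
have [|c /andP[mc cx] gE] :=
    mean_value (f := fun y => x * Phi y + phi y) (df := fun y => x * phi y + - y * phi y) _ mx.
  move=> y; have := is_derive_std_normal_cdf y; have := is_derive_std_normal_pdf y => dp dP.
  exact: (is_deriveD (is_deriveZ _ _) _).
have := std_normal_pdf_gt0 c; have := std_normal_pdf_gt0 m => phim phic.
have : x * (1 - Phi m) < e by rewrite mulrC -ltr_pdivlMr//; lra.
have : (c - x) * phi c * (m - x) >= 0 by rewrite !mulr_ge0// ?subr_ge0 ltW.
lra.
Qed.

Lemma std_normal_cdf_lipschitz x y : `|Phi y - Phi x| <= normal_peak 1 * `|y - x|.
Proof.
apply: (lipschitz_of_derive is_derive_std_normal_cdf) => z.
by rewrite ger0_norm ?normal_pdf_ge0// normal_pdf_ub ?oner_eq0.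
Qed.

End normal_cdf.

(* Test functions are taken of the form [k \o Phi]: the Gaussian integral of
   [k \o Phi] is then the increment of an antiderivative of [k] on [0, 1], so
   that Stein's equation is solved without integration and with bounds that do
   not depend on the location of the test function. *)
Section stein_equation.
Context {R : realType}.
Variables (H k : R -> R) (L : R).
Implicit Types x y u : R.
Hypothesis H_derive : forall u, is_derive u 1 H (k u).
Hypothesis k_ge0 : forall u, 0 <= k u.
Hypothesis k_le1 : forall u, k u <= 1.
Hypothesis k_lip : forall u v, `|k v - k u| <= L * `|v - u|.

Local Notation Phi := (@std_normal_cdf R).
Local Notation phi := (@normal_pdf R 0 1).

Let J := H 1 - H 0.

Let J01 : 0 <= J <= 1.
Proof.
have [c _ E] := mean_value H_derive (@ltr01 R).
by rewrite /J E subr0 mulr1 k_ge0 k_le1.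
Qed.

Let g u := H u - u * J.

Let g_derive u : is_derive u 1 g (k u - J).
Proof.
have -> : g = H - (J \*: id).
  by apply/funext => v; rewrite /g mulrC.
by apply: is_derive_eq; rewrite /GRing.scale/= mulr1.
Qed.

Let g_lip u v : `|g v - g u| <= `|v - u|.
Proof.
rewrite -[leRHS]mul1r; apply: (lipschitz_of_derive g_derive) => w.
by have := k_ge0 w; have := k_le1 w; case/andP: J01 => *; rewrite ler_norml; lra.
Qed.

(** The integral of [(k \o Phi - J) * phi] over []-oo, x]], numerator of the classical solution of
    Stein's equation. Since [g] is 1-Lipschitz and [g 0 = g 1], it is bounded by either tail of the
    normal law. *)
Let G x := g (Phi x) - g 0.

Let G_le x : `|G x| <= Phi x.
Proof.
by have := g_lip 0 (Phi x); rewrite subr0 (ger0_norm (std_normal_cdf_ge0 x)).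
Qed.

Let G_le' x : `|G x| <= 1 - Phi x.
Proof.
have := g_lip (Phi x) 1; rewrite (@ger0_norm _ (1 - Phi x)); last first.
  by rewrite subr_ge0 std_normal_cdf_le1.
by rewrite distrC /G (_ : g 1 = g 0)// /g /J; ring.
Qed.

Let G_derive x : is_derive x 1 G ((k (Phi x) - J) * phi x).
Proof.
have dP := is_derive_std_normal_cdf x; have dg := g_derive (Phi x).
have -> : G = (g \o Phi) - cst (g 0) by [].
by apply: is_derive_eq; rewrite subr0.
Qed.

Let f x := G x / phi x.
Let df x := x * f x + k (Phi x) - J.

Let f_derive x : is_derive x 1 f (df x).
Proof.
have phi0 : phi x != 0 by rewrite gt_eqF ?std_normal_pdf_gt0.
have dp : is_derive x 1 (fun y : R => (phi y)^-1) (x / phi x).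
  apply: (is_derive_eq (is_deriveV phi0 (is_derive_std_normal_pdf x))).
  by rewrite /GRing.scale/=; field.
apply: (is_derive_eq (is_deriveM (G_derive x) dp)).
by rewrite /df /f /GRing.scale/=; field.
Qed.

(** [G x] is at most the tail on the side of [x], and Mills' inequality bounds [|x|] times that tail
    by [phi x]. *)
Let xf_le1 x : `|x * f x| <= 1.
Proof.
rewrite /f mulrA normrM normfV (gtr0_norm (std_normal_pdf_gt0 x)).
rewrite ler_pdivrMr ?std_normal_pdf_gt0// mul1r normrM.
have [x0|x0|->] := ltgtP x 0.
- rewrite (ltr0_norm x0) (le_trans _ (std_normal_cdf_mills x0))//.
  by rewrite ler_wpM2l// oppr_ge0 ltW.
- rewrite (gtr0_norm x0) (le_trans _ (std_normal_ccdf_mills x0))//.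
  by rewrite ler_wpM2l// ltW.
- by rewrite normr0 mul0r normal_pdf_ge0.
Qed.

(** The two summands cover two ranges: for [|x| >= 1] the bound on [x * f x] gives 1, and for
    [|x| < 1] the denominator is at least [phi 1]. *)
Let f_le x : `|f x| <= 1 + (phi 1)^-1.
Proof.
have phi1 := std_normal_pdf_gt0 (1 : R).
have [x1|x1] := leP 1 `|x|.
  apply: (@le_trans _ _ 1); last by rewrite lerDl invr_ge0 ltW.
  by apply: le_trans (xf_le1 x); rewrite [leRHS]normrM ler_peMl.
apply: (@le_trans _ _ (phi 1)^-1); last by rewrite lerDr.
rewrite [`|f x|]normrM normfV (gtr0_norm (std_normal_pdf_gt0 x)).
rewrite -[leRHS]mul1r ler_pM// ?invr_ge0 ?normal_pdf_ge0//.
  exact: le_trans (G_le x) (std_normal_cdf_le1 x).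
rewrite lef_pV2 ?posrE ?std_normal_pdf_gt0// !std_normal_pdfE.
rewrite ler_wpM2l ?normal_peak_ge0// ler_expR ler_pM2r ?invr_gt0// lerN2.
by rewrite expr1n -(ger0_norm (sqr_ge0 x)) normrX expr_le1 // ltW.
Qed.

Let df_le2 x : `|df x| <= 2.
Proof.
have := k_ge0 (Phi x); have := k_le1 (Phi x); have := xf_le1 x.
by case/andP: J01 => ? ?; rewrite /df !ler_norml => /andP[]; lra.
Qed.

(** As [k] is merely Lipschitz, the quadratic remainder is obtained from the mean value theorem and
    an estimate of the increments of [dF]. The factor [|x|] comes from the term [x * F x] in [dF];
    it is affordable because the first absolute moment of the normalised sum is bounded. *)
Lemma stein_equation_solution :
  exists F dF : R -> R,
    [/\ forall x, dF x - x * F x = k (Phi x) - (H 1 - H 0),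
        forall x, `|dF x| <= 2
      & forall x y, `|F y - F x - dF x * (y - x)| <=
          (2 * `|x| + (1 + (phi 1)^-1 + L * normal_peak 1)) * (y - x) ^+ 2].
Proof.
exists f, df; split=> [x||x y]; [by rewrite /df /J; ring|exact: df_le2|].
have L0 : 0 <= L.
  by have := le_trans (normr_ge0 _) (k_lip 0 1); rewrite subr0 normr1 mulr1.
have [c cx ->] := mean_value_dist f_derive x y.
rewrite -mulrBl normrM -(ger0_norm (sqr_ge0 _)) normrX expr2 mulrA.
rewrite ler_wpM2r//.
have -> : df c - df x =
    (c - x) * f c + x * (f c - f x) + (k (Phi c) - k (Phi x)).
  by rewrite /df; ring.
have h1 : `|(c - x) * f c| <= `|y - x| * (1 + (phi 1)^-1).
  by rewrite normrM; apply: ler_pM => //; exact: f_le.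
have h2 : `|x * (f c - f x)| <= `|x| * (2 * `|y - x|).
  rewrite normrM ler_wpM2l//.
  by rewrite (le_trans (lipschitz_of_derive f_derive df_le2 _ _))// ler_wpM2l.
have h3 : `|k (Phi c) - k (Phi x)| <= L * (normal_peak 1 * `|y - x|).
  apply: (le_trans (k_lip _ _)); rewrite ler_wpM2l//.
  apply: (le_trans (std_normal_cdf_lipschitz _ _)).
  by rewrite ler_wpM2l ?normal_peak_ge0.
apply: (le_trans (ler_normD _ _)); apply: (le_trans (lerD (ler_normD _ _) h3)).
by apply: (le_trans (lerD (lerD h1 h2) (lexx _))); rewrite le_eqVlt; apply/orP; left; apply/eqP; ring.
Qed.

End stein_equation.

(** * Ramps, the piecewise affine test functions *)

Section ramp.
Context {R : realType}.
Implicit Types a d u v : R.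

(* Equal to 1 on ]-oo, a], to 0 on [a + d, +oo[, and affine in between. *)
Definition ramp a d u : R := (Num.max 0 (a + d - u) - Num.max 0 (a - u)) / d.

Definition ramp_int a d u : R :=
  (Num.max 0 (a - u) ^+ 2 - Num.max 0 (a + d - u) ^+ 2) / (2 * d).

Lemma is_derive_ramp_int a d u : 0 < d -> is_derive u 1 (ramp_int a d) (ramp a d u).
Proof.
(* Each of the two squared positive parts has a remainder of at most [(v - u) ^+ 2], on either side
   of its kink; the division by [2 * d] then gives [d^-1]. *)
move=> d0; apply: (is_derive_of_quadratic_bound (C := d^-1)) => v.
have pq (x y : R) : `|Num.max 0 y ^+ 2 - Num.max 0 x ^+ 2 - 2 * Num.max 0 x * (y - x)|
    <= (y - x) ^+ 2.
  rewrite ler_norml.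
  have := sqr_ge0 x; have := sqr_ge0 y; have := sqr_ge0 (y - x).
  have [x0|x0] := leP 0 x; have [y0|y0] := leP 0 y => *; apply/andP.
  - by split; lra.
  - by have := mulr_ge0 x0 (ltW (etrans (oppr_gt0 y) y0)); split; lra.
  - by have := mulr_ge0 (ltW (etrans (oppr_gt0 x) x0)) y0; split; lra.
  - by split; lra.
have := pq (a - u) (a - v); have := pq (a + d - u) (a + d - v).
rewrite /ramp_int /ramp.
move: (Num.max 0 (a - u)) (Num.max 0 (a - v)) (Num.max 0 (a + d - u)) (Num.max 0 (a + d - v)).
move=> p q r s h1 h2.
have -> : (q ^+ 2 - s ^+ 2) / (2 * d) - (p ^+ 2 - r ^+ 2) / (2 * d) - (r - p) / d * (v - u)
  = ((q ^+ 2 - p ^+ 2 - 2 * p * (a - v - (a - u))) - (s ^+ 2 - r ^+ 2 - 2 * r * (a + d - v - (a + d - u)))) / (2 * d).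
  by field; lra.
rewrite normrM (@ger0_norm _ (2 * d)^-1) ?invr_ge0; last by lra.
rewrite ler_pdivrMr; last by lra.
have -> : d^-1 * (v - u) ^+ 2 * (2 * d) = (v - u) ^+ 2 + (v - u) ^+ 2 by field; lra.
apply: (le_trans (ler_normB _ _)).
by rewrite lerD// ?(le_trans h1) ?(le_trans h2)//; nra.
Qed.

Lemma ramp_ge0 a d u : 0 < d -> 0 <= ramp a d u.
Proof.
move=> d0; rewrite /ramp divr_ge0 ?(ltW d0)// subr_ge0.
by rewrite ge_max !le_max lexx; apply/orP; right; lra.
Qed.

Lemma ramp_le1 a d u : 0 < d -> ramp a d u <= 1.
Proof.
move=> d0; rewrite /ramp ler_pdivrMr// mul1r lerBlDr ge_max.
apply/andP; split; first by rewrite addr_ge0 ?(ltW d0)// le_max lexx.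
by rewrite -lerBlDl le_max; apply/orP; right; lra.
Qed.

Lemma ramp_left a d u : 0 < d -> u <= a -> ramp a d u = 1.
Proof.
move=> d0 ua; rewrite /ramp !max_r; [|lra..].
by field; lra.
Qed.

Lemma ramp_right a d u : 0 < d -> a + d <= u -> ramp a d u = 0.
Proof.
move=> d0 ua; rewrite /ramp !max_l; [|lra..].
by rewrite subrr mul0r.
Qed.

Lemma ramp_lipschitz a d u v : 0 < d -> `|ramp a d v - ramp a d u| <= d^-1 * `|v - u|.
Proof.
move=> d0; wlog uv : u v / u <= v.
  by move=> h; case/orP: (le_total u v) => /h//; rewrite distrC (distrC v).
have m0 (x y : R) : x <= y -> 0 <= Num.max 0 y - Num.max 0 x <= y - x.
  by move=> xy; have [x0|x0] := leP 0 x; have [y0|y0] := leP 0 y; lra.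
rewrite /ramp -mulrBl normrM (@gtr0_norm _ d^-1) ?invr_gt0// mulrC.
rewrite ler_pM2l ?invr_gt0// ler_norml (@ger0_norm _ (v - u)) ?subr_ge0//.
have /m0/andP[] : a - v <= a - u by lra.
have /m0/andP[] : a + d - v <= a + d - u by lra.
lra.
Qed.

(** The ramp lies between the indicators of [u <= a] and [u <= a + d], so its integral over [[0, 1]]
    is close to [a]. This upper bound serves [a = Phi y]; the lower bound that follows serves
    [a = Phi y - d], possibly negative. *)
Lemma ramp_int_le a d : 0 < d -> 0 <= a -> ramp_int a d 1 - ramp_int a d 0 <= a + d.
Proof.
move=> d0 a0; rewrite /ramp_int -mulrBl ler_pdivrMr ?subr0; last by lra.
rewrite (@max_r _ _ 0 a)// (@max_r _ _ 0 (a + d)); last by lra.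
have : 0 <= Num.max 0 (a - 1) <= Num.max 0 (a + d - 1).
  by rewrite le_max lexx/= ge_max !le_max lexx/=; apply/orP; right; lra.
by case/andP => *; nra.
Qed.

Lemma ramp_int_ge a d : 0 < d -> a <= 1 -> a <= ramp_int a d 1 - ramp_int a d 0.
Proof.
move=> d0 a1; rewrite /ramp_int -mulrBl ler_pdivlMr ?subr0; last by lra.
rewrite (@max_l _ _ 0 (a - 1)) ?expr0n/=; last by lra.
case: (lerP 0 (a + d - 1)) => ?; case: (lerP 0 a) => ?;
  case: (lerP 0 (a + d)) => ?; nra.
Qed.

End ramp.

(** * Uniform means over a finite set and their symmetries *)

Section unif_mean_theory.
Context {R : realType} (T : finType) (A : {set T}).
Implicit Types f g : T -> R.

Lemma unif_meanD f g :
  unif_mean A (fun s => f s + g s) = unif_mean A f + unif_mean A g.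
Proof. by rewrite /unif_mean big_split/= mulrDl. Qed.

Lemma unif_meanZ (c : R) f : unif_mean A (fun s => c * f s) = c * unif_mean A f.
Proof. by rewrite /unif_mean -mulr_sumr mulrA. Qed.

Lemma unif_meanN f : unif_mean A (fun s => - f s) = - unif_mean A f.
Proof. by rewrite /unif_mean sumrN mulNr. Qed.

Lemma unif_meanB f g :
  unif_mean A (fun s => f s - g s) = unif_mean A f - unif_mean A g.
Proof. by rewrite unif_meanD unif_meanN. Qed.

Lemma unif_mean_sum (I : Type) (r : seq I) (P : pred I) (F : I -> T -> R) :
  unif_mean A (fun s => \sum_(i <- r | P i) F i s) =
  \sum_(i <- r | P i) unif_mean A (F i).
Proof. by rewrite /unif_mean exchange_big/= mulr_suml. Qed.

Lemma eq_unif_mean f g :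
  {in A, f =1 g} -> unif_mean A f = unif_mean A g.
Proof. by move=> fg; rewrite /unif_mean (eq_bigr _ fg). Qed.

Lemma le_unif_mean f g :
  (forall s, s \in A -> f s <= g s) -> unif_mean A f <= unif_mean A g.
Proof. by move=> fg; rewrite /unif_mean ler_wpM2r ?invr_ge0// ler_sum. Qed.

Lemma norm_unif_mean f : `|unif_mean A f| <= unif_mean A (fun s => `|f s|).
Proof.
rewrite /unif_mean normrM (@ger0_norm _ (_^-1)) ?invr_ge0//.
by rewrite ler_wpM2r ?invr_ge0// ler_norm_sum.
Qed.

Lemma unif_mean_cst (c : R) : (0 < #|A|)%N -> unif_mean A (fun=> c) = c.
Proof.
move=> A0; rewrite /unif_mean sumr_const -[c *+ _]mulr_natr mulfK//.
by rewrite pnatr_eq0 -lt0n.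
Qed.

Lemma unif_mean_stable (tau : T -> T) f :
  {in A, forall s, tau s \in A} -> injective tau ->
  unif_mean A (f \o tau) = unif_mean A f.
Proof.
move=> tauA tau_inj; congr (_ / _).
have imA : tau @: A = A.
  apply/eqP; rewrite eqEcard card_imset// leqnn andbT.
  by apply/fintype.subsetP => _ /imsetP[s sA ->]; exact: tauA.
by rewrite -[in RHS]imA big_imset//=; exact: in2W.
Qed.

Lemma unif_mean_odd (tau : T -> T) f :
  {in A, forall s, tau s \in A} -> injective tau ->
  {in A, forall s, f (tau s) = - f s} -> unif_mean A f = 0.
Proof.
move=> tauA tau_inj fN; have := unif_mean_stable f tauA tau_inj.
by rewrite (@eq_unif_mean _ (fun s => - f s))// unif_meanN; lra.
Qed.

End unif_mean_theory.

(** * Sums over neighbouring indices *)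

Section neighbours.
Context {R : realType}.
Implicit Types (y : nat -> R) (j k : nat).

Definition neighbour_sum y j : R :=
  (if j is i.+1 then y i else 0) + y j + y j.+1.

Lemma sumr_ord1 y N j : (forall k, (N <= k)%N -> y k = 0) ->
  \sum_(k < N | k == j :> nat) y k = y j.
Proof. by move=> yN; rewrite big_ord1_eq; case: ltnP => // /yN. Qed.

Lemma sum_neighbours y N j : (forall k, (N <= k)%N -> y k = 0) ->
  \sum_(k < N | (k <= j.+1)%N && (j <= k.+1)%N) y k = neighbour_sum y j.
Proof.
move=> yN; rewrite (bigID (fun k : 'I_N => k == j :> nat))/=.
rewrite [X in _ + X](bigID (fun k : 'I_N => k == j.+1 :> nat))/= addrA addrC addrA.
rewrite /neighbour_sum; congr (_ + _ + _).
- case: j => [|i]; first by rewrite big_pred0// => k; lia.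
  by rewrite -(sumr_ord1 i yN); apply: eq_bigl => k; lia.
- by rewrite -(sumr_ord1 j yN); apply: eq_bigl => k; lia.
- by rewrite -(sumr_ord1 j.+1 yN); apply: eq_bigl => k; lia.
Qed.

(** Each product of two adjacent terms occurs twice, once from either side; [y M.+1 = 0] removes the
    product that leaves the range. *)
Lemma sum_mul_neighbours y M : y M.+1 = 0 ->
  \sum_(j < M.+1) y j * neighbour_sum y j =
  \sum_(j < M.+1) y j ^+ 2 + 2 * \sum_(j < M) y j * y j.+1.
Proof.
move=> yM.
have -> : \sum_(j < M.+1) y j * neighbour_sum y j =
  \sum_(j < M.+1) y j * (if nat_of_ord j is i.+1 then y i else 0) +
  \sum_(j < M.+1) y j ^+ 2 + \sum_(j < M.+1) y j * y j.+1.
  by rewrite -!big_split/=; apply: eq_bigr => j _; rewrite /neighbour_sum; case: (nat_of_ord j) => [|i]; ring.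
rewrite big_ord_recl/= mulr0 add0r [X in _ + _ + X]big_ord_recr/= yM mulr0 addr0.
under eq_bigr => j _ do rewrite /bump/= add1n mulrC.
by ring.
Qed.

Lemma sum_near_le M i :
  \sum_(j < M | (j <= i.+2)%N && (i <= j.+2)%N) (1 : R) <= 5.
Proof.
have S1 m : \sum_(j < M | j == m :> nat) (1 : R) <= 1.
  by rewrite (@big_ord1_eq _ _ _ (fun=> 1)); case: ifP.
rewrite big_mkcond/=.
(* For small [i] the truncated [i.-1] and [i.-2] repeat an index, which can only enlarge this upper
   bound. *)
apply: (@le_trans _ _ (\sum_(j < M) (
  (if j == i :> nat then 1 else 0) + (if j == i.+1 :> nat then 1 else 0) +
  (if j == i.+2 :> nat then 1 else 0) + (if j == i.-1 :> nat then 1 else 0) +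
  (if j == i.-2 :> nat then 1 else 0)))).
  apply: ler_sum => j _.
  by case: ifP => ?; do 5![case: eqP => ?]; lra || (exfalso; lia).
rewrite !big_split/= -!big_mkcond/=.
by have := S1 i; have := S1 i.+1; have := S1 i.+2; have := S1 i.-1; have := S1 i.-2; lra.
Qed.

End neighbours.

(** The bound [14 * (K1 + K2 + K3)] of Stein's method with [K1 = 2], [K3 = 2] and the bracket as
    [K2], the constants of the Stein solution for a ramp of slope [d^-1]. The last summand pays for
    the perturbation [e]; [normal_peak 1] is the Lipschitz constant of [Phi]. *)
Definition kolmogorov_const {R : realType} (d : R) : R :=
  14 * (2 + (1 + (normal_pdf 0 1 1)^-1 + d^-1 * normal_peak 1) + 2)
  + d^-1 * normal_peak 1.

(** * Stein's method for locally dependent signs *)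

Section local_dependence.
Context {R : realType} (T : finType) (A : {set T}) (M : nat).
Variables (x : nat -> T -> R) (tau : nat -> T -> T).
Local Notation E := (unif_mean A).
Implicit Types (i j k : nat) (s : T).

Hypothesis A_gt0 : (0 < #|A|)%N.
Hypothesis x_sqr : forall j s, (j <= M)%N -> x j s ^+ 2 = 4^-1.
Hypothesis x_out : forall j s, (M < j)%N -> x j s = 0.
Hypothesis tau_inj : forall j, injective (tau j).
Hypothesis tau_stable : forall j s, (j <= M)%N -> s \in A -> tau j s \in A.
Hypothesis x_tau : forall j s, (j <= M)%N -> s \in A -> x j (tau j s) = - x j s.
Hypothesis x_tau_far : forall j k s, (j <= M)%N -> s \in A ->
  ~~ ((k <= j.+1)%N && (j <= k.+1)%N) -> x k (tau j s) = x k s.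
Hypothesis cov_next : forall j, (j < M)%N ->
  E (fun s => x j s * x j.+1 s) = - 12^-1.
Hypothesis cov_far : forall i j, (i.+2 < j)%N -> (j < M)%N ->
  E (fun s => (x i s * x i.+1 s + 12^-1) * (x j s * x j.+1 s + 12^-1)) = 0.

Let V s := \sum_(j < M.+1) x j s.
Let nb j s := neighbour_sum (x^~ s) j.
Let Q j s := x j s * x j.+1 s + 12^-1.

Let V_nb j s : V s - nb j s =
  \sum_(k < M.+1 | ~~ ((k <= j.+1)%N && (j <= k.+1)%N)) x k s.
Proof.
rewrite /V /nb -(@sum_neighbours _ _ M.+1) => [|k Mk]; last exact: x_out.
by rewrite (bigID (fun k : 'I_M.+1 => (k <= j.+1)%N && (j <= k.+1)%N))/= addrAC subrr add0r.
Qed.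

(** [tau j] negates [x j] and fixes every term of [V - nb j], so the integrand is odd under a
    bijection of [A]. *)
Let mean_far (g : R -> R) j : (j <= M)%N -> E (fun s => x j s * g (V s - nb j s)) = 0.
Proof.
move=> jM; apply: (@unif_mean_odd _ _ _ (tau j)) => // s sA; first exact: tau_stable.
rewrite x_tau// mulNr !V_nb; congr (- (_ * g _)).
by apply: eq_bigr => k; exact: x_tau_far.
Qed.

Let x_le j s : `|x j s| <= 2^-1.
Proof.
have [jM|jM] := leqP j M; last by rewrite x_out// normr0 invr_ge0.
have := x_sqr s jM; rewrite ler_norml => xx; apply/andP; split; nra.
Qed.

Let nb_le j s : `|nb j s| <= 3 / 2.
Proof.
have x0 i : `|x i s| <= 2^-1 by [].
rewrite /nb /neighbour_sum.
apply: (le_trans (ler_normD _ _)); apply: (le_trans (lerD (ler_normD _ _) (x0 _))).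
have : `|if j is i.+1 then x i s else 0| <= 2^-1.
  by case: j => [|i]//; rewrite normr0 invr_ge0.
by have := x0 j; lra.
Qed.

(** The squares give [(M + 1) / 4] and centring the products gives [- M / 6], in total
    [(M + 3) / 12]. It is written as [(M + 4) / 12 - 12^-1] to exhibit the variance [sigma ^+ 2] of
    the full descent number. *)
Lemma sum_neighbours_centered s :
  \sum_(j < M.+1) x j s * neighbour_sum (x^~ s) j =
  (M + 4)%:R / 12 + 2 * (\sum_(j < M) (x j s * x j.+1 s + 12^-1)) - 12^-1.
Proof.
rewrite sum_mul_neighbours ?x_out// (eq_bigr (fun=> 4^-1)); last first.
  by move=> j _; rewrite x_sqr// -ltnS.
rewrite big_split/= !sumr_const !card_ord -(mulr_natr 4^-1) -(mulr_natr 12^-1).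
by rewrite natrD -natr1; field.
Qed.

Lemma mean_local_sum_sqr : E (fun s => V s ^+ 2) = (M + 3)%:R / 12.
Proof.
have VE s : V s ^+ 2 = \sum_(j < M.+1) (x j s * nb j s + x j s * (V s - nb j s)).
  by rewrite expr2 {1}/V mulr_suml; apply: eq_bigr => j _; ring.
rewrite (eq_unif_mean (fun s _ => VE s)).
under eq_unif_mean => s _ do rewrite big_split/= sum_neighbours_centered.
rewrite !(unif_meanB, unif_meanD, unif_meanZ, unif_mean_sum, unif_mean_cst)//.
rewrite (eq_bigr (fun=> 0)) => [|j _]; last first.
  by rewrite unif_meanD unif_mean_cst// cov_next// addNr.
rewrite [X in _ + X](eq_bigr (fun=> 0)) => [|j _]; last first.
  by rewrite (mean_far id)// -ltnS.
by rewrite !sumr_const !mul0rn !natrD; lra.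
Qed.

(** Only pairs of indices at distance at most 2 contribute. There are at most five for each [i], and
    each contributes at most 1/9 because [|Q j s| <= 1/4 + 1/12 = 1/3]. *)
Lemma mean_local_cov_sqr : E (fun s => (\sum_(j < M) Q j s) ^+ 2) <= M%:R.
Proof.
have Q_le j s : `|Q j s| <= 3^-1.
  have := x_le j s; have := x_le j.+1 s; rewrite /Q => xj1 xj.
  have := ler_pM (normr_ge0 _) (normr_ge0 _) xj xj1; rewrite -normrM !ler_norml.
  by case/andP => *; lra.
have QQ i j : (i < M)%N -> (j < M)%N -> E (fun s => Q i s * Q j s) <=
    if (j <= i.+2)%N && (i <= j.+2)%N then 9^-1 else 0.
  move=> iM jM; case: ifPn => ij.
    rewrite -[leRHS](unif_mean_cst _ A_gt0); apply: le_unif_mean => s _.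
    apply: le_trans (ler_norm _) _; rewrite normrM.
    by apply: le_trans (ler_pM _ _ (Q_le i s) (Q_le j s)) _ => //; lra.
  have [h|h] := ltnP i.+2 j; first by rewrite cov_far.
  under eq_unif_mean => s _ do rewrite mulrC.
  by rewrite cov_far//; lia.
have -> : E (fun s => (\sum_(j < M) Q j s) ^+ 2) =
    \sum_(i < M) \sum_(j < M) E (fun s => Q i s * Q j s).
  rewrite (@eq_unif_mean _ _ _ _ (fun s => \sum_(i < M) \sum_(j < M) Q i s * Q j s)).
    by rewrite unif_mean_sum; apply: eq_bigr => i _; rewrite unif_mean_sum.
  move=> s _; rewrite expr2 mulr_suml.
  by apply: eq_bigr => i _; rewrite mulr_sumr.
apply: (@le_trans _ _ (\sum_(i < M) 1)); last by rewrite sumr_const card_ord.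
apply: ler_sum => i _; apply: (le_trans (ler_sum _ (fun (j : 'I_M) _ => QQ i j (ltn_ord i) (ltn_ord j)))).
rewrite -big_mkcond/=.
have -> : \sum_(j < M | (j <= i.+2)%N && (i <= j.+2)%N) (9^-1 : R) =
  9^-1 * \sum_(j < M | (j <= i.+2)%N && (i <= j.+2)%N) 1.
  by rewrite mulr_sumr; apply: eq_bigr => j _; rewrite mulr1.
by have := sum_near_le (R := R) M i; lra.
Qed.

Variable sigma : R.
Hypothesis sigma_gt0 : 0 < sigma.
Hypothesis sigma_sqr : sigma ^+ 2 = (M + 4)%:R / 12.

Let W s := V s / sigma.

Let mean_W : E (fun s => `|W s|) <= 1.
Proof.
apply: (@le_trans _ _ (E (fun s => 2^-1 + 2^-1 * (sigma ^- 2 * V s ^+ 2)))).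
  apply: le_unif_mean => s _.
  have -> : sigma ^- 2 * V s ^+ 2 = `|W s| ^+ 2.
    by rewrite -normrX ger0_norm ?sqr_ge0// /W exprMn exprVn mulrC.
  by have := sqr_ge0 (`|W s| - 1); lra.
rewrite unif_meanD !unif_meanZ unif_mean_cst// mean_local_sum_sqr.
have : sigma ^- 2 * ((M + 3)%:R / 12) <= 1; last by lra.
by rewrite mulrC ler_pdivrMr ?exprn_gt0// sigma_sqr !natrD; lra.
Qed.

(** By [mean_far], [x j * F ((V - nb j) / sigma)] has mean zero. Expanding [F] at [W] gives [x j * F
    W - x j * (nb j / sigma) * dF W + x j * r j]. Summing over [j] and dividing by [sigma] compares
    [W * F W] with [dF W] times a factor that differs from 1 by [(12^-1 - 2 * S) / sigma ^+ 2],
    where [S] has a small second moment. *)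
Lemma stein_local_dependence (F dF : R -> R) (K1 K2 K3 : R) :
  0 <= K1 -> 0 <= K2 ->
  (forall w, `|dF w| <= K3) ->
  (forall w w', `|F w' - F w - dF w * (w' - w)| <= (K1 * `|w| + K2) * (w' - w) ^+ 2) ->
  `|E (fun s => dF (W s) - W s * F (W s))| <= 14 * (K1 + K2 + K3) / sigma.
Proof.
move=> K1_ge0 K2_ge0 dF_le F_taylor.
have K3_ge0 : 0 <= K3 := le_trans (normr_ge0 _) (dF_le 0).
have sigma0 : sigma != 0 by rewrite gt_eqF.
pose r j s := F (W s - nb j s / sigma) - F (W s) - dF (W s) * (- (nb j s / sigma)).
pose S s := \sum_(j < M) Q j s.
have r_le j s : `|r j s| <= (K1 * `|W s| + K2) * (9 / 4 / sigma ^+ 2).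
  have := F_taylor (W s) (W s - nb j s / sigma).
  rewrite (_ : W s - nb j s / sigma - W s = - (nb j s / sigma)); last by ring.
  move=> /le_trans; apply.
  rewrite ler_wpM2l ?addr_ge0 ?mulr_ge0// sqrrN exprMn exprVn.
  rewrite ler_wpM2r ?invr_ge0 ?exprn_ge0 ?(ltW sigma_gt0)//.
  by rewrite -(ger0_norm (sqr_ge0 (nb j s))) normrX; have := nb_le j s; have := normr_ge0 (nb j s); nra.
have -> : E (fun s => dF (W s) - W s * F (W s)) =
    E (fun s => dF (W s) * ((12^-1 - 2 * S s) / sigma ^+ 2) +
      \sum_(j < M.+1) x j s * r j s / sigma).
  apply/eqP; rewrite -subr_eq0 -unif_meanB; apply/eqP.
  rewrite (@eq_unif_mean _ _ _ _ (fun s => - sigma^-1 * \sum_(j < M.+1) x j s * F ((V s - nb j s) / sigma))).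
    rewrite unif_meanZ unif_mean_sum big1 ?mulr0// => j _.
    by rewrite (mean_far (fun v => F (v / sigma)))// -ltnS.
  move=> s _; have TE := sum_neighbours_centered s.
  have -> : \sum_(j < M.+1) x j s * r j s / sigma =
     sigma^-1 * \sum_(j < M.+1) x j s * F ((V s - nb j s) / sigma)
     - W s * F (W s) + dF (W s) * (\sum_(j < M.+1) x j s * nb j s) / sigma ^+ 2.
    have -> : W s * F (W s) = \sum_(j < M.+1) x j s * (F (W s) / sigma).
      by rewrite -mulr_suml -/(V s) /W; ring.
    rewrite !mulr_sumr mulr_suml -sumrN -!big_split/=.
    by apply: eq_bigr => j _; rewrite /r mulrBl -/(W s); field.
  rewrite TE -sigma_sqr -/(S s) {TE}.
  by field.
apply: (le_trans (norm_unif_mean _ _)).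
(* The constant 14 covers both parts: [12^-1 + sigma + 12 * sigma <= 14 * sigma] for the factor of
   [dF], and [12 * (9 / 8) = 13.5] for the remainders, with 12 bounding [M.+1 / sigma ^+ 2]. *)
apply: (@le_trans _ _ (E (fun s => K3 * ((12^-1 + sigma + sigma^-1 * S s ^+ 2) / sigma ^+ 2) +
   14 * (K1 * `|W s| + K2) / sigma))).
  apply: le_unif_mean => s _; apply: (le_trans (ler_normD _ _)); apply: lerD.
    rewrite normrM ler_pM// normrM normfV (@ger0_norm _ (sigma ^+ 2)) ?sqr_ge0//.
    rewrite ler_wpM2r ?invr_ge0 ?sqr_ge0//.
    apply: (le_trans (ler_normB _ _)); rewrite ger0_norm ?invr_ge0//.
    rewrite -addrA lerD2l normrM ger0_norm//.
    (* This is [2 * |S| <= sigma + S ^+ 2 / sigma], weighted so that both terms on the right have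
       mean of order [sigma]. *)
    have : 0 <= sigma^-1 * (`|S s| - sigma) ^+ 2 by rewrite mulr_ge0 ?sqr_ge0 ?invr_ge0 ?ltW.
    rewrite -(ger0_norm (sqr_ge0 (S s))) normrX.
    have -> : sigma^-1 * (`|S s| - sigma) ^+ 2 = sigma^-1 * `|S s| ^+ 2 - 2 * `|S s| + sigma by field.
    by lra.
  apply: (le_trans (ler_norm_sum _ _ _)).
  apply: (@le_trans _ _ (\sum_(j < M.+1) 2^-1 * ((K1 * `|W s| + K2) * (9 / 4 / sigma ^+ 2)) / sigma)).
    apply: ler_sum => j _; rewrite normrM normfV (gtr0_norm sigma_gt0).
    by rewrite ler_wpM2r ?invr_ge0 ?(ltW sigma_gt0)// normrM ler_pM.
  rewrite sumr_const card_ord -[leLHS]mulr_natl.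
  have M1 : M.+1%:R / sigma ^+ 2 <= 12.
    by rewrite ler_pdivrMr ?exprn_gt0// sigma_sqr natrD -natr1; lra.
  have K0 : 0 <= (K1 * `|W s| + K2) / sigma.
    by rewrite divr_ge0 ?(ltW sigma_gt0)// addr_ge0 ?mulr_ge0.
  have -> : M.+1%:R * (2^-1 * ((K1 * `|W s| + K2) * (9 / 4 / sigma ^+ 2)) / sigma) =
    (M.+1%:R / sigma ^+ 2) * ((K1 * `|W s| + K2) / sigma) * (9 / 8) by field.
  have := ler_wpM2r K0 M1; rewrite -[14 * _ / _]mulrA; lra.
rewrite unif_meanD unif_meanZ.
under [X in _ * X + _]eq_unif_mean => s _ do rewrite mulrC.
under [X in _ + X]eq_unif_mean => s _ do rewrite mulrAC.
rewrite !unif_meanZ !unif_meanD !unif_meanZ !unif_mean_cst//.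
have -> : 14 * (K1 + K2 + K3) / sigma = K3 * (14 / sigma) + 14 / sigma * (K1 * 1 + K2) by ring.
apply: lerD.
  rewrite ler_wpM2l//.
  have s1 : 12^-1 <= sigma.
    have s3 : 3^-1 <= sigma ^+ 2 by rewrite sigma_sqr natrD; have := ler0n R M; lra.
    by rewrite -(@ler_pXn2r _ 2) ?nnegrE ?invr_ge0 ?(ltW sigma_gt0)//; lra.
  have ME : sigma^-1 * E (fun s => S s ^+ 2) <= 12 * sigma.
    rewrite mulrC ler_pdivrMr// -mulrA -expr2 sigma_sqr.
    by have := mean_local_cov_sqr; rewrite natrD; lra.
  rewrite mulrC ler_pdivrMr ?exprn_gt0//.
  have -> : 14 / sigma * sigma ^+ 2 = 14 * sigma by field.
  by lra.
rewrite ler_wpM2l ?divr_ge0 ?(ltW sigma_gt0)// lerD2r.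
by rewrite ler_wpM2l.
Qed.

Variables (e : T -> R).
Hypothesis e_le : forall s, `|e s| <= 2^-1.

Local Notation Phi := (@std_normal_cdf R).

Let mean_ramp (a d : R) : 0 < d ->
  `|E (fun s => ramp a d (Phi ((e s + V s) / sigma))) -
    (ramp_int a d 1 - ramp_int a d 0)| <= kolmogorov_const d / sigma.
Proof.
move=> d0.
have [F [dF [FE dF_le F_taylor]]] := stein_equation_solution
  (fun u => is_derive_ramp_int a u d0) (fun u => ramp_ge0 a u d0)
  (fun u => ramp_le1 a u d0) (fun u v => ramp_lipschitz a u v d0).
have dP0 : 0 <= d^-1 * normal_peak 1 by rewrite mulr_ge0 ?normal_peak_ge0 ?invr_ge0 ?ltW.
have K2_ge0 : 0 <= 1 + (normal_pdf 0 1 1)^-1 + d^-1 * normal_peak 1 :> R.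
  by rewrite !addr_ge0// invr_ge0 normal_pdf_ge0.
have := stein_local_dependence (ler0n _ 2) K2_ge0 dF_le F_taylor.
rewrite (eq_unif_mean (fun s _ => FE (W s))) unif_meanB unif_mean_cst// => h1.
have h2 : `|E (fun s => ramp a d (Phi ((e s + V s) / sigma))) -
    E (fun s => ramp a d (Phi (W s)))| <= d^-1 * normal_peak 1 / sigma.
  rewrite -unif_meanB; apply: (le_trans (norm_unif_mean _ _)).
  rewrite -[leRHS](unif_mean_cst _ A_gt0); apply: le_unif_mean => s _.
  apply: (le_trans (ramp_lipschitz _ _ _ d0)).
  rewrite -mulrA ler_wpM2l ?invr_ge0 ?(ltW d0)//.
  apply: (le_trans (std_normal_cdf_lipschitz _ _)).
  rewrite ler_wpM2l ?normal_peak_ge0// /W -mulrBl addrK normrM normfV (gtr0_norm sigma_gt0).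
  rewrite -[leRHS]mul1r ler_wpM2r ?invr_ge0 ?(ltW sigma_gt0)//.
  by have := e_le s; lra.
rewrite -(subrKA (E (fun s => ramp a d (Phi (W s))))).
apply: (le_trans (ler_normD _ _)); apply: (le_trans (lerD h2 h1)).
by rewrite /kolmogorov_const [leRHS]mulrDl addrC.
Qed.

(** The indicator of [Y <= y] lies between the ramps starting at [Phi y - d] and at [Phi y],
    evaluated at [Phi Y]; their integrals over [[0, 1]] are within [d] of [Phi y]. The error of
    [mean_ramp] does not depend on where the ramp starts, whence uniformity in [y]. *)
Theorem kolmogorov_local_dependence (d y : R) : 0 < d ->
  `|E (fun s => ((e s + V s) / sigma <= y)%R%:R) - Phi y| <= d + kolmogorov_const d / sigma.
Proof.
move=> d0; set Y := fun s => (e s + V s) / sigma.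
have up : E (fun s => (Y s <= y)%R%:R) <= E (fun s => ramp (Phi y) d (Phi (Y s))).
  apply: le_unif_mean => s _; case: (leP (Y s) y) => [Yy|_]; last exact: ramp_ge0.
  by rewrite ramp_left// std_normal_cdf_nondecreasing.
have dn : E (fun s => ramp (Phi y - d) d (Phi (Y s))) <= E (fun s => (Y s <= y)%R%:R).
  apply: le_unif_mean => s _; case: (leP (Y s) y) => [Yy|yY]; first exact: ramp_le1.
  by rewrite ramp_right// subrK std_normal_cdf_nondecreasing// ltW.
have := mean_ramp (Phi y) d0; have := mean_ramp (Phi y - d) d0.
rewrite !ler_norml => /andP[h1 h2] /andP[h3 h4].
have := ramp_int_le d0 (std_normal_cdf_ge0 y).
have : Phi y - d <= 1 by have := std_normal_cdf_le1 y; lra.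
move/(ramp_int_ge d0); rewrite -/Y in h1 h2 h3 h4 * => *.
by apply/andP; split; lra.
Qed.

End local_dependence.

Arguments entry : simpl never.

(** * Signed words: sign changes, permutations of positions, parities *)

Section signed_words.
Variable n : nat.
Implicit Types (s g : {perm letter n}) (i j : 'I_n) (p : 'S_n).

Definition wval s i : int := letter_val (s (i, false)).

Lemma entry_ord s i : entry s i.+1 = wval s i.
Proof.
rewrite /entry /window (nth_map i) ?size_enum_ord//.
by rewrite (nth_ord_enum i).
Qed.

Lemma signed_permN s i : s \in signed_perms n -> s (i, true) = letter_opp (s (i, false)).
Proof. by rewrite inE => /forallP/(_ (i, false))/eqP. Qed.

Lemma norm_letter_val (x : letter n) : `|letter_val x| = (x.1.+1)%:Z.
Proof. by case: x => i []; rewrite /letter_val/= ?normrN. Qed.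

Lemma letter_val_opp (x : letter n) : letter_val (letter_opp x) = - letter_val x.
Proof. by case: x => i []; rewrite /letter_val/= ?opprK. Qed.

Lemma wval_neq0 s i : wval s i != 0.
Proof. by rewrite -normr_eq0 norm_letter_val. Qed.

Lemma norm_wval_inj s : s \in signed_perms n -> injective (fun i => `|wval s i|).
Proof.
move=> ss i j; rewrite !norm_letter_val => -[/val_inj e1].
have : s (j, false) = s (i, false) \/ s (j, false) = s (i, true).
  rewrite (signed_permN i ss) /letter_opp; case: (s (i, false)) e1 => a c.
  by case: (s (j, false)) => b d /= ->; case: c; case: d; by [left|right].
by case=> /perm_inj[].
Qed.

Definition flip_letter (a b : 'I_n) (x : letter n) : letter n :=
  (x.1, x.2 (+) ((x.1 == a) || (x.1 == b))).

Lemma flip_letterK a b : involutive (flip_letter a b).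
Proof. by move=> [i c]; rewrite /flip_letter/= addbK. Qed.

(** Products of permutations apply the left factor first, so left multiplication by [flip a b], and
    by [place p] below, acts on the positions of the window. *)
Definition flip a b : {perm letter n} := perm (inv_inj (flip_letterK a b)).

Definition place_letter p (x : letter n) : letter n := (p x.1, x.2).

Lemma place_letter_inj p : injective (place_letter p).
Proof. by move=> [i c] [j d] [/perm_inj-> ->]. Qed.

Definition place p : {perm letter n} := perm (@place_letter_inj p).

Lemma flip_signed a b : flip a b \in signed_perms n.
Proof.
rewrite inE; apply/forallP => -[i c].
by rewrite !permE /flip_letter /letter_opp/= addNb.
Qed.

Lemma place_signed p : place p \in signed_perms n.
Proof. by rewrite inE; apply/forallP => -[i c]; rewrite !permE. Qed.

Lemma wval_flip a b s i : s \in signed_perms n ->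
  wval (flip a b * s)%g i =
  if (i == a) || (i == b) then - wval s i else wval s i.
Proof.
move=> ss; rewrite /wval permM permE /flip_letter/=.
by case: ifP => _ //=; rewrite signed_permN// letter_val_opp.
Qed.

Lemma wval_place p s i : wval (place p * s)%g i = wval s (p i).
Proof. by rewrite /wval permM permE. Qed.

Lemma sign_card (T : finType) (P : pred T) :
  (-1) ^+ #|[set x | P x]| = \prod_x (if P x then -1 else 1) :> int.
Proof.
rewrite -sum1_card (big_morph _ (exprD (-1)) (expr0 _)) big_mkcond/=.
by apply: eq_bigr => x _; rewrite inE.
Qed.

Lemma sign_negs s : (-1) ^+ odd (negs s) = \prod_i Num.sg (wval s i) :> int.
Proof.
rewrite signr_odd sign_card; apply: eq_bigr => i _; rewrite entry_ord.
by have [/ltr0_sg->|/gtr0_sg->|/eqP] := ltgtP (wval s i) 0;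
  rewrite ?(negbTE (wval_neq0 s i)).
Qed.

(** The Vandermonde product of the absolute values. As a determinant it is multiplied by the sign of
    [p] under a permutation [p] of positions, with no inversions to count. *)
Definition norm_inv s : int :=
  \prod_(i < n) \prod_(j < n | (i < j)%N) (`|wval s j| - `|wval s i|).

(* A pair [i < j] contributes an odd number to [invD] iff [|pi_i| > |pi_j|]:
   the parity of [invD] is that of the underlying unsigned permutation. *)
Lemma sign_invD s : s \in signed_perms n ->
  (-1) ^+ odd (invD s) = Num.sg (norm_inv s) :> int.
Proof.
move=> ss; rewrite signr_odd /invD exprD !sign_card -big_split/=.
rewrite /norm_inv pair_big_dep/=.
rewrite (big_morph _ (@sgrM _) (@sgr1 _)) [RHS]big_mkcond/=.
apply: eq_bigr => -[i j] _; rewrite !entry_ord/=.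
case: ltnP => // ij.
have : `|wval s i| != `|wval s j|.
  by rewrite (inj_eq (norm_wval_inj ss)) neq_ltn ij.
have := wval_neq0 s i; have := wval_neq0 s j.
move: (wval s i) (wval s j) => a b b0 a0 ab.
have [h|h|h] := sgrP (`|b| - `|a|); case: ifPn => h1; case: ifPn => h2;
  rewrite ?expr1 ?mulr1 ?mul1r ?mulrN1 ?opprK//; exfalso; lia.
Qed.

Lemma norm_inv_Vandermonde s :
  norm_inv s = \det (Vandermonde n (\row_i `|wval s i|)).
Proof.
rewrite det_Vandermonde; apply: eq_bigr => i _; apply: eq_bigr => j _.
by rewrite !mxE.
Qed.

Lemma norm_inv_place p s : norm_inv (place p * s)%g = (-1) ^+ p * norm_inv s.
Proof.
rewrite !norm_inv_Vandermonde.
have -> : Vandermonde n (\row_i `|wval (place p * s)%g i|) =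
    col_perm p (Vandermonde n (\row_i `|wval s i|)).
  by apply/matrixP => i j; rewrite !mxE wval_place.
by rewrite col_permE det_mulmx det_perm mulrC odd_permV.
Qed.

Lemma norm_inv_flip a b s : s \in signed_perms n ->
  norm_inv (flip a b * s)%g = norm_inv s.
Proof.
move=> ss; apply: eq_bigr => i _; apply: eq_bigr => j _.
by rewrite !wval_flip//; congr (_ - _); case: ifP; rewrite ?normrN.
Qed.

Definition even_signed_parity (c : bool) : {set {perm letter n}} :=
  [set s in even_signed_perms n | odd (invD s) == c].

Lemma signed_of_parity c s : s \in even_signed_parity c -> s \in signed_perms n.
Proof. by rewrite !inE => /andP[/andP[]]. Qed.

Lemma even_signed_place p s :
  (place p * s \in even_signed_perms n)%g = (s \in even_signed_perms n).
Proof.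
rewrite inE [RHS]inE (groupMl _ (place_signed p)); congr (_ && ~~ _).
apply: (@signr_inj int); rewrite !sign_negs.
by rewrite [RHS](reindex_perm p)/=; apply: eq_bigr => i _; rewrite wval_place.
Qed.

Lemma parity_place c p s : s \in even_signed_parity c ->
  (place p * s)%g \in even_signed_parity (p (+) c).
Proof.
move=> sA; move: (sA); rewrite inE => /andP[se /eqP sc].
rewrite inE even_signed_place se/=; apply/eqP/(@signr_inj int).
rewrite sign_invD ?groupM ?place_signed ?(signed_of_parity sA)//.
rewrite norm_inv_place sgrM -sign_invD ?(signed_of_parity sA)// sc signr_addb.
by congr (_ * _); case: (odd_perm p); rewrite /= ?expr1 ?sgrN ?sgr1.
Qed.

Lemma parity_flip c a b s : a != b -> s \in even_signed_parity c ->
  (flip a b * s)%g \in even_signed_parity c.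
Proof.
move=> ab sA; have ss := signed_of_parity sA; move: (sA); rewrite !inE.
have /= := groupM (flip_signed a b) ss; rewrite inE => ->; rewrite inE in ss; rewrite ss/=.
have -> : odd (negs (flip a b * s)%g) = odd (negs s).
  apply: (@signr_inj int); rewrite !sign_negs.
  rewrite (bigD1 a)//= (bigD1 b)//=; last by rewrite eq_sym.
  rewrite [RHS](bigD1 a)//= [in RHS](bigD1 b)//=; last by rewrite eq_sym.
  have ss' := signed_of_parity sA.
  rewrite !wval_flip// !eqxx orbT/= !sgrN [LHS]mulrA mulrNN -[LHS]mulrA; congr (_ * (_ * _)).
  by apply: eq_bigr => i /andP[ia ib]; rewrite wval_flip// (negbTE ia) (negbTE ib).
have -> : odd (invD (flip a b * s)%g) = odd (invD s).
  have ss' := signed_of_parity sA.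
  apply: (@signr_inj int); rewrite !sign_invD ?norm_inv_flip//.
  by rewrite groupM ?flip_signed.
by [].
Qed.

End signed_words.

(** The identity lies in one of the two classes, whichever it is; exchanging its first two positions
    carries it into the other. *)
Lemma even_signed_parity_gt0 n c : (0 < #|even_signed_parity n.+2 c|)%N.
Proof.
have e1 : (1%g : {perm letter n.+2}) \in even_signed_perms n.+2.
  rewrite inE group1/= /negs.
  rewrite (_ : [set _ | _] = finset.set0) ?cards0//.
  by apply/setP => i; rewrite !inE entry_ord /wval perm1.
have p1 : (1%g : {perm letter n.+2}) \in even_signed_parity n.+2 (odd (invD (1%g : {perm letter n.+2}))).
  by rewrite inE e1 eqxx.
apply/card_gt0P.
have [<-|] := eqVneq (odd (invD (1%g : {perm letter n.+2}))) c; first by eexists; exact: p1.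
move=> oc; exists (place (tperm ord0 (lift ord0 ord0)) * 1)%g.
have := parity_place (tperm ord0 (lift ord0 ord0)) p1; rewrite odd_tperm/=.
by move: oc; case: odd; case: c.
Qed.

(** * Descent signs and their sum over the sign changes of a block *)

Section descent_sign.
Context {R : realType}.
Implicit Types a b d : int.

Definition descent_sign a b : R := (b < a)%R%:R - 2^-1.

Lemma descent_sign_sqr a b : descent_sign a b ^+ 2 = 4^-1.
Proof. by rewrite /descent_sign; case: (b < a) => /=; field. Qed.

Lemma descent_signC a b : a != b -> descent_sign b a = - descent_sign a b.
Proof.
by rewrite /descent_sign; have [h|h|//] := ltgtP a b => _; rewrite /=; field.
Qed.

Lemma descent_signN a b : a != b -> descent_sign (- a) (- b) = - descent_sign a b.
Proof. by move=> ab; rewrite -descent_signC// /descent_sign ltrN2. Qed.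

(* Summing over the sign changes of an even number of the three letters leaves
   only the words whose middle letter is the largest in absolute value. *)
Lemma descent_sign_block a b d :
  `|a| != `|b| -> `|b| != `|d| -> b != 0 ->
  descent_sign a b * descent_sign b d +
  descent_sign (- a) (- b) * descent_sign (- b) d +
  descent_sign a (- b) * descent_sign (- b) (- d) +
  descent_sign (- a) b * descent_sign b (- d) =
  - ((`|a| < `|b|) && (`|d| < `|b|))%:R.
Proof.
move=> ab bd b0.
rewrite (descent_signN (a := a)); last by apply: contraNneq ab => ->.
rewrite (descent_signN (a := b)); last by apply: contraNneq bd => ->.
rewrite (_ : descent_sign (- a) b = - descent_sign a (- b)); last first.
  rewrite -descent_signN ?opprK//; apply: contraNneq ab => ->.
  by rewrite normrN.
rewrite (_ : descent_sign b (- d) = - descent_sign (- b) d); last first.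
  rewrite -descent_signN ?opprK//; apply: contraNneq bd => <-.
  by rewrite normrN.
(* The four products factor. Each factor vanishes unless [|b|] exceeds the outer letter, and the two
   surviving values have opposite signs. *)
have -> : forall p q t u : R, p * q + - p * t + u * - q + - u * - t = (p - u) * (q - t).
  by move=> *; ring.
have -> : descent_sign a b - descent_sign a (- b) =
    if `|a| < `|b| then if 0 < b then -1 else 1 else 0 :> R.
  rewrite /descent_sign; case: (ltrP `|a| `|b|) => ?; case: (ltrP 0 b) => ?;
    case: (ltrP b a) => ?; case: (ltrP (- b) a) => ?; rewrite /=; lra || (exfalso; lia).
have -> : descent_sign b d - descent_sign (- b) d =
    if `|d| < `|b| then if 0 < b then 1 else -1 else 0 :> R.
  rewrite /descent_sign; case: (ltrP `|d| `|b|) => ?; case: (ltrP 0 b) => ?;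
    case: (ltrP d b) => ?; case: (ltrP d (- b)) => ?; rewrite /=; lra || (exfalso; lia).
by case: (`|a| < `|b|); case: (`|d| < `|b|); case: (0 < b); rewrite /=; ring.
Qed.

End descent_sign.

(** * Blocks of three adjacent positions in a parity class *)

Section parity_classes.
Context {R : realType} (M : nat) (c : bool).
Local Notation n := M.+2.
Local Notation A := (even_signed_parity n c).
Local Notation E := (@unif_mean R _ A).
Implicit Types (s : {perm letter n}) (a b j k : nat).

Lemma entry_inord s k : (k < n)%N -> entry s k.+1 = wval s (inord k).
Proof. by move=> kn; rewrite -entry_ord inordK. Qed.

Lemma entry_neq0 s k : (k < n)%N -> entry s k.+1 != 0.
Proof. by move=> kn; rewrite entry_inord// wval_neq0. Qed.

Lemma norm_entry_neq s j k : s \in signed_perms n -> (j < n)%N -> (k < n)%N ->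
  j != k -> `|entry s j.+1| != `|entry s k.+1|.
Proof.
move=> ss jn kn jk; rewrite !entry_inord// (inj_eq (norm_wval_inj ss)).
by rewrite -val_eqE/= !inordK.
Qed.

Lemma entry_neq s j k : s \in signed_perms n -> (j < n)%N -> (k < n)%N ->
  j != k -> entry s j.+1 != entry s k.+1.
Proof.
by move=> ss jn kn jk; apply: contraNneq (norm_entry_neq ss jn kn jk) => ->.
Qed.

Definition nflip a b s : {perm letter n} :=
  (flip (inord a : 'I_n) (inord b : 'I_n) * s)%g.

Lemma nflip_inj a b : injective (nflip a b).
Proof. exact: mulgI. Qed.

Lemma nflip_stable a b s : (a < n)%N -> (b < n)%N -> a != b ->
  s \in A -> nflip a b s \in A.
Proof.
by move=> an bn ab; apply: parity_flip; rewrite -val_eqE/= !inordK.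
Qed.

Lemma entry_nflip a b s k : s \in signed_perms n ->
  (a < n)%N -> (b < n)%N -> (k < n)%N ->
  entry (nflip a b s) k.+1 =
  if (k == a) || (k == b) then - entry s k.+1 else entry s k.+1.
Proof.
move=> ss an bn kn; rewrite !entry_inord// wval_flip//.
by rewrite -!val_eqE/= !inordK.
Qed.

(** Two transpositions make an even permutation: sharing a position they form the 3-cycle that
    rotates a block, and disjoint ones correct the parity of a single exchange. *)
Definition nswap2 a b a' b' s : {perm letter n} :=
  (place (tperm (inord a : 'I_n) (inord b) * tperm (inord a') (inord b')) * s)%g.

Lemma nswap2_inj a b a' b' : injective (nswap2 a b a' b').
Proof. exact: mulgI. Qed.

Lemma nswap2_stable a b a' b' s : (a < n)%N -> (b < n)%N -> a != b ->
  (a' < n)%N -> (b' < n)%N -> a' != b' -> s \in A -> nswap2 a b a' b' s \in A.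
Proof.
move=> an bn ab an' bn' ab' sA.
have := parity_place (tperm (inord a : 'I_n) (inord b) * tperm (inord a') (inord b'))%g sA.
by rewrite odd_permM !odd_tperm -!val_eqE/= !inordK// ab ab'.
Qed.

Lemma entry_nswap2 a b a' b' s k :
  (a < n)%N -> (b < n)%N -> (a' < n)%N -> (b' < n)%N -> (k < n)%N ->
  let k1 := if k == a then b else if k == b then a else k in
  let k2 := if k1 == a' then b' else if k1 == b' then a' else k1 in
  entry (nswap2 a b a' b' s) k.+1 = entry s k2.+1.
Proof.
move=> an bn an' bn' kn k1 k2; rewrite entry_inord// wval_place permM.
have tE (u v w : nat) : (u < n)%N -> (v < n)%N -> (w < n)%N ->
    tperm (inord u : 'I_n) (inord v) (inord w) =
    inord (if w == u then v else if w == v then u else w).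
  move=> un vn wn; rewrite permE/= -!val_eqE/= !inordK//.
  by case: ifP => // _; case: ifP.
have k1n : (k1 < n)%N by rewrite /k1; do 2?case: ifP.
have k2n : (k2 < n)%N by rewrite /k2; do 2?case: ifP.
by rewrite !tE// -entry_inord.
Qed.

Local Notation ds := (@descent_sign R).

(* For [sg = true] and [j = 0] the first factor is the descent sign at
   position 0, since [- pi_2 > pi_1] iff [- pi_1 > pi_2]. *)
Let pair_sign (sg : bool) j s : R :=
  ds ((-1) ^+ sg * entry s j.+1) (entry s j.+2) * ds (entry s j.+2) (entry s j.+3).

(** The function [g] depends only on the letters outside the block, so it is unaffected by moves
    inside. Averaging over sign changes leaves -1/4 of the event that the middle letter is largest
    in absolute value, and rotations give this event weight 1/3. Constant [g] yields the covariance,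
    a distant product the absence of correlation. *)
Lemma mean_pair_sign (sg : bool) j (g : {perm letter n} -> R) : (j < M)%N ->
  (forall s t, s \in A -> t \in A ->
    (forall k, (k < n)%N -> ~~ (j <= k < j.+3)%N -> entry s k.+1 = entry t k.+1) ->
    g s = g t) ->
  E (fun s => (ds ((-1) ^+ sg * entry s j.+1) (entry s j.+2) *
    ds (entry s j.+2) (entry s j.+3) + 12^-1) * g s) = 0.
Proof.
move=> jM g_inv.
have [j0 j1 j2] : [/\ j < n, j.+1 < n & j.+2 < n]%N by split; lia.
have [e01 e02 e12] : [/\ (j == j.+1) = false, (j == j.+2) = false & (j.+1 == j.+2) = false]
  by split; lia.
have [e10 e20 e21] : [/\ (j.+1 == j) = false, (j.+2 == j) = false & (j.+2 == j.+1) = false]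
  by split; lia.
pose mid s : R := ((`|entry s j.+1| < `|entry s j.+2|) && (`|entry s j.+3| < `|entry s j.+2|))%:R.
have inv (tau : {perm letter n} -> {perm letter n}) (f : {perm letter n} -> R) :
    {in A, forall s, tau s \in A} -> injective tau ->
    (forall s k, s \in A -> (k < n)%N -> ~~ (j <= k < j.+3)%N ->
       entry (tau s) k.+1 = entry s k.+1) ->
    E (fun s => f (tau s) * g s) = E (fun s => f s * g s).
  move=> tauA tau_inj tauE.
  rewrite -[RHS](unif_mean_stable _ tauA tau_inj); apply: eq_unif_mean => s sA /=.
  congr (_ * _); apply: g_inv => // [|k kn kj]; first exact: tauA.
  by rewrite tauE.
have inv_flip a b f : (a < n)%N -> (b < n)%N -> a != b -> (j <= a < j.+3)%N -> (j <= b < j.+3)%N ->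
    E (fun s => f (nflip a b s) * g s) = E (fun s => f s * g s).
  move=> an bn ab aj bj; apply: inv; [by move=> s; exact: nflip_stable|exact: nflip_inj|].
  move=> s k sA kn kj; rewrite entry_nflip ?(signed_of_parity sA)//.
  by case: ifP => // /orP[]/eqP kE; move: kj; rewrite kE ?aj ?bj.
have signs : E (fun s => pair_sign sg j s * g s) = - 4^-1 * E (fun s => mid s * g s).
  have h1 := inv_flip j j.+1 (pair_sign sg j) j0 j1 _ _ _.
  have h2 := inv_flip j.+1 j.+2 (pair_sign sg j) j1 j2 _ _ _.
  have h3 := inv_flip j j.+2 (pair_sign sg j) j0 j2 _ _ _.
  have : E (fun s => pair_sign sg j s * g s) + E (fun s => pair_sign sg j (nflip j j.+1 s) * g s) +
      E (fun s => pair_sign sg j (nflip j.+1 j.+2 s) * g s) + E (fun s => pair_sign sg j (nflip j j.+2 s) * g s)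
      = E (fun s => (-1) * (mid s * g s)).
    rewrite -!unif_meanD; apply: eq_unif_mean => s sA.
    have ss := signed_of_parity sA.
    rewrite /pair_sign !entry_nflip//.
    rewrite !(e01, e02, e12, e10, e20, e21, eqxx, orbT, orbF)/=.
    rewrite !mulrN -!mulrDl mulrA; congr (_ * _); rewrite descent_sign_block ?entry_neq0//.
    - by rewrite /mid normrM normrX normrN1 expr1n mul1r mulN1r.
    - by rewrite normrM normrX normrN1 expr1n mul1r norm_entry_neq// ?e01 ?e12.
    - by rewrite norm_entry_neq// ?e01 ?e12.
  rewrite h1 ?h2 ?h3 ?unif_meanZ; [lra|lia..].
(* Exactly one of the three rotations puts the largest absolute value in the middle; ties are
   excluded because absolute values are distinct. *)
have rot : E (fun s => mid s * g s) = 3^-1 * E g.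
  pose rho := nswap2 j j.+1 j.+1 j.+2.
  have rhoA s : s \in A -> rho s \in A by apply: nswap2_stable => //; lia.
  have rhoE s k : (k < n)%N -> entry (rho s) k.+1 =
      entry s (if k == j then j.+2 else if k == j.+1 then j
               else if k == j.+2 then j.+1 else k).+1.
    move=> kn; rewrite entry_nswap2//=; congr (entry s _.+1).
    have [kj|k0] := eqVneq k j; first by rewrite ?kj !(e01, e02, e12, eqxx).
    have [kj|k1] := eqVneq k j.+1; first by rewrite ?kj !(e01, e02, e12, eqxx).
    by rewrite (negbTE k1).
  have rho_out s k : s \in A -> (k < n)%N -> ~~ (j <= k < j.+3)%N ->
      entry (rho s) k.+1 = entry s k.+1.
    by move=> sA kn kj; rewrite rhoE//; do 3![case: eqP => [?|_]; first lia].
  have r0 s : entry (rho s) j.+1 = entry s j.+3 by rewrite rhoE ?eqxx.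
  have r1 s : entry (rho s) j.+2 = entry s j.+1 by rewrite rhoE ?e10 ?eqxx.
  have r2 s : entry (rho s) j.+3 = entry s j.+2 by rewrite rhoE ?e20 ?e21 ?eqxx.
  have h1 f := inv rho f rhoA (@nswap2_inj _ _ _ _) rho_out.
  have : E (fun s => mid s * g s) + E (fun s => mid (rho s) * g s) +
      E (fun s => mid (rho (rho s)) * g s) = E g.
    rewrite -!unif_meanD; apply: eq_unif_mean => s sA; rewrite -!mulrDl.
    rewrite -[RHS]mul1r; congr (_ * _).
    have ss := signed_of_parity sA.
    rewrite /mid !(r0, r1, r2).
    have := norm_entry_neq ss j0 j1 (negbT e01).
    have := norm_entry_neq ss j1 j2 (negbT e12).
    have := norm_entry_neq ss j0 j2 (negbT e02).
    by do 3![case: ltgtP => //= ?]; rewrite ?(addr0, add0r)//; exfalso; lia.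
  by rewrite h1 (h1 (mid \o rho)) h1; lra.
rewrite (@eq_unif_mean _ _ _ _ (fun s => pair_sign sg j s * g s + 12^-1 * g s)).
  by rewrite unif_meanD unif_meanZ signs rot; lra.
by move=> s _; rewrite mulrDl.
Qed.

End parity_classes.

(** * Mean, variance and normal approximation of the descent number *)

Section descent_statistics.
Context {R : realType} (M : nat) (c : bool).
Local Notation n := M.+2.
Local Notation A := (even_signed_parity n c).
Local Notation E := (@unif_mean R _ A).
Local Notation ds := (@descent_sign R).
Implicit Types (s : {perm letter n}) (j k : nat).

(** Indices are shifted: [des_sign j] belongs to position [j.+1], so that [j <= M] covers positions
    1 to n - 1. The value 0 beyond [M] spares the neighbour sums a boundary case. *)
Definition des_sign j s : R :=
  if (j <= M)%N then ds (entry s j.+1) (entry s j.+2) else 0.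

Definition des_sign0 s : R := ds (entry s 0) (entry s 1).

Lemma desD_sum s :
  (desD s)%:R = n%:R / 2 + (des_sign0 s + \sum_(j < M.+1) des_sign j s) :> R.
Proof.
have -> : (desD s)%:R = \sum_(i < n) (entry s i.+1 < entry s i)%R%:R :> R.
  rewrite /desD -sum1_card natr_sum big_mkcond/=.
  by apply: eq_bigr => i _; rewrite inE; case: ifP.
rewrite big_ord_recl/=.
have -> : \sum_(i < M.+1) (entry s (bump 0 i).+1 < entry s (bump 0 i))%R%:R =
    \sum_(i < M.+1) (des_sign i s + 2^-1) :> R.
  apply: eq_bigr => i _; rewrite /des_sign /descent_sign /bump/= add1n.
  by rewrite -ltnS ltn_ord subrK.
rewrite big_split/= sumr_const card_ord -(mulr_natr 2^-1) /des_sign0 /descent_sign.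
by rewrite -(natr1 M.+1); field.
Qed.

Lemma des_sign_sqr j s : (j <= M)%N -> des_sign j s ^+ 2 = 4^-1.
Proof. by rewrite /des_sign => ->; rewrite descent_sign_sqr. Qed.

Lemma des_sign_out j s : (M < j)%N -> des_sign j s = 0.
Proof. by rewrite /des_sign ltnNge => /negbTE->. Qed.

Let tau j := @nflip M j j.+1.

Let tau_stable j s : (j <= M)%N -> s \in A -> tau j s \in A.
Proof. by move=> jM; apply: nflip_stable; lia. Qed.

Let entry_tau j k s : (j <= M)%N -> s \in A -> (k < n)%N ->
  entry (tau j s) k.+1 =
  if (k == j) || (k == j.+1) then - entry s k.+1 else entry s k.+1.
Proof.
by move=> jM sA kn; rewrite entry_nflip ?(signed_of_parity sA)//; lia.
Qed.

Let des_sign_tau j s : (j <= M)%N -> s \in A -> des_sign j (tau j s) = - des_sign j s.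
Proof.
move=> jM sA; rewrite /des_sign jM !entry_tau ?eqxx ?orbT//=; last lia.
by rewrite descent_signN// (entry_neq (signed_of_parity sA))//; lia.
Qed.

Let des_sign_tau_far j k s : (j <= M)%N -> s \in A ->
  ~~ ((k <= j.+1)%N && (j <= k.+1)%N) -> des_sign k (tau j s) = des_sign k s.
Proof.
move=> jM sA kj; rewrite /des_sign; case: ifP => // kM.
by rewrite !entry_tau ?ifN//; lia.
Qed.

(** Position 0 compares [- pi_2] with [pi_1]: it involves the same two letters as position 1 and is
    reversed by the same flip. *)
Let des_sign0_tau s : s \in A -> des_sign0 (tau 0 s) = - des_sign0 s.
Proof.
move=> sA; rewrite /des_sign0 [entry _ 0]/(- entry _ 2) [entry s 0]/(- entry _ 2).
rewrite !entry_tau//= descent_signN//.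
have := norm_entry_neq (signed_of_parity sA) (isT : 0 < n)%N (isT : 1 < n)%N isT.
by apply: contraNneq => <-; rewrite normrN.
Qed.

Lemma mean_des_sign j : E (des_sign j) = 0.
Proof.
have [jM|jM] := leqP j M; last first.
  by rewrite /unif_mean big1 ?mul0r// => s _; exact: des_sign_out.
apply: (@unif_mean_odd _ _ _ (tau j)); [by move=> s; exact: tau_stable| |].
  exact: nflip_inj.
by move=> s; exact: des_sign_tau.
Qed.

Lemma mean_des_sign0 : E des_sign0 = 0.
Proof.
apply: (@unif_mean_odd _ _ _ (tau 0)); [by move=> s; exact: tau_stable| |].
  exact: nflip_inj.
exact: des_sign0_tau.
Qed.

Lemma mean_desD : E (fun s => (desD s)%:R) = n%:R / 2.
Proof.
rewrite (eq_unif_mean (fun s _ => desD_sum s)) unif_meanD unif_meanD unif_mean_sum.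
rewrite [X in _ + (X + _)]mean_des_sign0 unif_mean_cst ?even_signed_parity_gt0//.
rewrite big1 ?addr0// => j _.
exact: mean_des_sign.
Qed.

Let cov_block j (g : {perm letter n} -> R) : (j < M)%N ->
  (forall s t, s \in A -> t \in A ->
    (forall k, (k < n)%N -> ~~ (j <= k < j.+3)%N -> entry s k.+1 = entry t k.+1) ->
    g s = g t) ->
  E (fun s => (des_sign j s * des_sign j.+1 s + 12^-1) * g s) = 0.
Proof.
move=> jM g_inv; rewrite -[RHS](mean_pair_sign false jM g_inv).
by apply: eq_unif_mean => s _; rewrite /des_sign jM (ltnW jM) expr0 mul1r.
Qed.

Lemma mean_des_sign_next j : (j < M)%N ->
  E (fun s => des_sign j s * des_sign j.+1 s) = - 12^-1.
Proof.
move=> jM; have := @cov_block j (fun=> 1) jM (fun _ _ _ _ _ => erefl).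
under eq_unif_mean => s _ do rewrite mulr1.
rewrite unif_meanD unif_mean_cst ?even_signed_parity_gt0//.
by move/eqP; rewrite addr_eq0 => /eqP.
Qed.

Lemma mean_des_sign_far i j : (i.+2 < j)%N -> (j < M)%N ->
  E (fun s => (des_sign i s * des_sign i.+1 s + 12^-1) *
    (des_sign j s * des_sign j.+1 s + 12^-1)) = 0.
Proof.
move=> ij jM; apply: cov_block => [|s t _ _ st]; first lia.
by rewrite /des_sign jM (ltnW jM) !st//; lia.
Qed.

Lemma mean_des_sign_sum_sqr :
  E (fun s => (\sum_(j < M.+1) des_sign j s) ^+ 2) = (M + 3)%:R / 12.
Proof.
apply: (@mean_local_sum_sqr R _ A M des_sign tau).
- exact: even_signed_parity_gt0.
- exact: des_sign_sqr.
- exact: des_sign_out.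
- by move=> j; exact: nflip_inj.
- exact: tau_stable.
- exact: des_sign_tau.
- exact: des_sign_tau_far.
- exact: mean_des_sign_next.
Qed.

(** Only [j = 1] contributes: there [- pi_1], [pi_2], [pi_3] form a block, treated by
    [mean_pair_sign] with a sign. For [j >= 2] the flip of the first two letters negates [des_sign0]
    alone. *)
Lemma mean_des_sign0_cross : (2 <= M)%N ->
  E (fun s => des_sign0 s * \sum_(j < M.+1) des_sign j s) = - 12^-1.
Proof.
move=> M2; have M0 : (0 < M)%N by lia.
rewrite (@eq_unif_mean _ _ _ _ (fun s => \sum_(j < M.+1) des_sign0 s * des_sign j s)); last first.
  by move=> s _; rewrite mulr_sumr.
rewrite unif_mean_sum -(big_mkord xpredT (fun j => E (fun s => des_sign0 s * des_sign j s))).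
have ds0E s : s \in A -> des_sign0 s = ds (- entry s 1) (entry s 2).
  by move=> sA; rewrite /des_sign0 /descent_sign [entry s 0]/(- entry _ 2) ltrNr.
rewrite big_ltn// big_ltn// big_nat big1 => [|j /andP[j2 jM]]; last first.
  apply: (@unif_mean_odd _ _ _ (tau 0)); [by move=> s; exact: tau_stable| |].
    exact: nflip_inj.
  by move=> s sA; rewrite des_sign0_tau// des_sign_tau_far ?mulNr//; lia.
(* Exchanging the first two letters preserves [des_sign0] and negates [des_sign 0]. The exchange of
   the third and fourth letters restores the parity; this is where n must be at least 4. *)
have -> : E (fun s => des_sign0 s * des_sign 0 s) = 0.
  apply: (@unif_mean_odd _ _ _ (@nswap2 M 0 1 2 3)).
  - by move=> s; apply: nswap2_stable => //; lia.
  - exact: nswap2_inj.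
  move=> s sA; rewrite /des_sign0 /des_sign/= [entry _ 0]/(- entry _ 2) [entry s 0]/(- entry _ 2).
  rewrite !(entry_nswap2 (a := 0) (b := 1) (a' := 2) (b' := 3))//=.
  rewrite (descent_signC (a := entry s 1)) ?mulrN; last first.
    by rewrite (entry_neq (signed_of_parity sA)).
  by rewrite /descent_sign ltrNr.
rewrite addr0 add0r.
have := @mean_pair_sign R M c true 0 (fun=> 1) M0 (fun _ _ _ _ _ => erefl).
rewrite (@eq_unif_mean _ _ _ _ (fun s => des_sign0 s * des_sign 1 s + 12^-1)).
  rewrite unif_meanD unif_mean_cst ?even_signed_parity_gt0//.
  by move/eqP; rewrite addr_eq0 => /eqP.
by move=> s sA; rewrite mulr1 ds0E// /des_sign M0 expr1 mulN1r.
Qed.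

Lemma unif_var_desD : (2 <= M)%N ->
  unif_var A (fun s => (desD s)%:R : R) = (n + 2)%:R / 12.
Proof.
move=> M2; rewrite /unif_var mean_desD.
rewrite (@eq_unif_mean _ _ _ _ (fun s => des_sign0 s ^+ 2 +
  2 * (des_sign0 s * \sum_(j < M.+1) des_sign j s) + (\sum_(j < M.+1) des_sign j s) ^+ 2)).
  (* The three contributions are [1/4], [- 2/12] and [(M + 3) / 12], which add up to
     [(M + 4) / 12]. *)
  rewrite !unif_meanD unif_meanZ mean_des_sign0_cross// mean_des_sign_sum_sqr.
  rewrite (eq_unif_mean (fun s _ => descent_sign_sqr _ _)).
  rewrite unif_mean_cst ?even_signed_parity_gt0//.
  by rewrite (_ : (n + 2 = M + 4)%N) ?natrD; [lra|lia].
by move=> s _; rewrite desD_sum; ring.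
Qed.

Lemma kolmogorov_desD (d y : R) : (2 <= M)%N -> 0 < d ->
  `|E (fun s => ((desD s)%:R <= y * Num.sqrt ((n + 2)%:R / 12) + n%:R / 2)%R%:R)
    - std_normal_cdf y| <= d + kolmogorov_const d / Num.sqrt ((n + 2)%:R / 12).
Proof.
move=> M2 d0.
have s0 : 0 < (n + 2)%:R / 12 :> R by rewrite divr_gt0 ?ltr0n.
have sq0 : 0 < Num.sqrt ((n + 2)%:R / 12) :> R by rewrite sqrtr_gt0.
have := @kolmogorov_local_dependence R _ A M des_sign tau
  (even_signed_parity_gt0 _ _) des_sign_sqr des_sign_out
  (fun j => @nflip_inj _ _ _) tau_stable des_sign_tau des_sign_tau_far
  mean_des_sign_next mean_des_sign_far _ sq0 _ des_sign0 _ d y d0.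
rewrite (@eq_unif_mean _ _ _ _
  (fun s => ((desD s)%:R <= y * Num.sqrt ((n + 2)%:R / 12) + n%:R / 2)%R%:R)).
  apply.
  - by rewrite sqr_sqrtr ?(ltW s0)// (_ : (n + 2 = M + 4)%N)//; lia.
  - move=> s; rewrite /des_sign0 /descent_sign ler_norml.
    by case: (_ < _) => /=; lra.
by move=> s _; rewrite desD_sum ler_pdivrMr// [in RHS]addrC lerD2r.
Qed.

End descent_statistics.

(** * The coefficient distribution as the law of [desD] *)

Section coefficient_distribution.
Context {R : realType} (n : nat) (A : {set {perm letter n}}).
Local Notation P := (desD_poly R A).

Lemma desD_poly_coef k : P`_k = \sum_(s in A) (k == desD s)%:R.
Proof. by rewrite coef_sum; apply: eq_bigr => s _; rewrite coefXn. Qed.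

Lemma desD_poly_horner1 : P.[1] = #|A|%:R.
Proof.
rewrite horner_sum (eq_bigr (fun=> 1)) ?sumr_const// => s _.
by rewrite hornerXn expr1n.
Qed.

(** Coefficients are sums of nonnegative terms, so none cancels at an attained value; sums cut off
    at [size P] therefore see every word. *)
Lemma desD_lt_size_poly s : s \in A -> (desD s < size P)%N.
Proof.
move=> sA; rewrite ltnNge; apply/negP => /(nth_default 0).
rewrite desD_poly_coef => /eqP; rewrite psumr_eq0// => /allP/(_ s).
by rewrite mem_index_enum sA eqxx oner_eq0 => /(_ isT).
Qed.

Lemma sum_coef_prob (g : nat -> R) :
  \sum_(k < size P) g k * coef_prob P k = unif_mean A (fun s => g (desD s)).
Proof.
rewrite /coef_prob /unif_mean desD_poly_horner1.
under eq_bigr do rewrite desD_poly_coef mulrA mulr_sumr.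
rewrite -mulr_suml exchange_big/=; congr (_ / _); apply: eq_bigr => s sA.
rewrite (bigD1 (Ordinal (desD_lt_size_poly sA)))//= eqxx mulr1 big1 ?addr0// => k.
by rewrite -val_eqE/= => /negbTE->; rewrite mulr0.
Qed.

Lemma coef_mean_desD : coef_mean P = unif_mean A (fun s => (desD s)%:R).
Proof. exact: (sum_coef_prob (fun k => k%:R)). Qed.

Lemma coef_var_desD : coef_var P = unif_var A (fun s => (desD s)%:R).
Proof.
rewrite /coef_var coef_mean_desD.
exact: (sum_coef_prob (fun k => (k%:R - unif_mean A (fun s => (desD s)%:R)) ^+ 2)).
Qed.

Lemma coef_cdf_dist_desD y : coef_cdf_dist P y =
  `|unif_mean A (fun s => ((desD s)%:R <=
       y * Num.sqrt (unif_var A (fun s => (desD s)%:R)) +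
       unif_mean A (fun s => (desD s)%:R))%R%:R)
    - std_normal_cdf y|.
Proof.
rewrite /coef_cdf_dist coef_var_desD coef_mean_desD; congr `|_ - _|.
rewrite -(sum_coef_prob (fun k => (k%:R <= _)%R%:R)) big_mkcond/=.
apply: eq_bigr => k _; rewrite floor_ge_int -pmulrn.
by case: ifP; rewrite ?mul1r ?mul0r.
Qed.

End coefficient_distribution.

(** * Choice of the ramp width and passage to the limit *)

Section asymptotics.
Context {R : realType}.
Local Open Scope classical_set_scope.

Let sigma (m : nat) : R := Num.sqrt ((m.+2 + 2)%:R / 12).

(** This width balances the two error terms [d] and [d^-1 / sigma]: both become of order
    [delta m]. *)
Let delta (m : nat) : R := Num.sqrt (sigma m)^-1.

Let sigma_gt0 m : 0 < sigma m.
Proof. by rewrite sqrtr_gt0 divr_gt0 ?ltr0n. Qed.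

Let delta_gt0 m : 0 < delta m.
Proof. by rewrite sqrtr_gt0 invr_gt0. Qed.

Let cvg_sqrt0 (u : nat -> R) : u @ \oo --> 0 -> (fun m => Num.sqrt (u m)) @ \oo --> 0.
Proof.
move=> u0; rewrite -[X in _ --> X](@sqrtr0 R).
exact: (continuous_cvg _ (@sqrt_continuous R 0) u0).
Qed.

Let cvg_delta : delta @ \oo --> 0.
Proof.
apply: cvg_sqrt0.
have -> : (fun m => (sigma m)^-1) = (fun m => Num.sqrt (12 * (m + 4)%:R^-1)).
  apply/funext => m; rewrite /sigma -sqrtrV ?divr_ge0// invf_div.
  by rewrite (_ : (m.+2 + 2 = m + 4)%N)//; lia.
apply: cvg_sqrt0; rewrite -[X in _ --> X](mulr0 12).
apply: cvgM; first exact: cvg_cst.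
have := @cvg_harmonic R; rewrite -(cvg_shiftn 3).
by under eq_fun do rewrite /harmonic/= -addnS.
Qed.

Let bound m : R := delta m + kolmogorov_const (delta m) / sigma m.

Let cvg_bound : bound @ \oo --> 0.
Proof.
pose al : R := 14 * (2 + (1 + (normal_pdf 0 1 1)^-1) + 2).
(* The terms of [kolmogorov_const] in [d^-1]: 14 from Stein's method and 1 from the perturbation.
   Multiplied by [(sigma m)^-1 = delta m * delta m] they leave one factor [delta m]. *)
pose be : R := 15 * normal_peak 1.
have -> : bound = (fun m => delta m * (1 + be) + al * (delta m * delta m)).
  apply/funext => m; rewrite /bound /kolmogorov_const.
  have dE : delta m * delta m = (sigma m)^-1.
    by rewrite -expr2 sqr_sqrtr// invr_ge0 ltW.
  have d0 : delta m != 0 by rewrite gt_eqF.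
  rewrite -dE /al /be; move: (normal_pdf 0 1 1)^-1 (normal_peak 1) => p q.
  by field.
rewrite -[X in _ --> X]addr0; apply: cvgD.
  by rewrite -[X in _ --> X](mul0r (1 + be)); apply: cvgM; [exact: cvg_delta|exact: cvg_cst].
rewrite -[X in _ --> X](mulr0 al); apply: cvgM; first exact: cvg_cst.
by rewrite -[X in _ --> X](mulr0 0); apply: cvgM; exact: cvg_delta.
Qed.

Lemma asymptotically_normal_desD (c : bool) :
  asymptotically_normal (fun m => desD_poly R (even_signed_parity m.+2 c)).
Proof.
apply: (squeeze_cvge (f := cst 0%E) (h := EFin \o bound)); last 2 first.
- exact: cvg_cst.
- by apply/fine_cvgP; split; [exact: nearW|exact: cvg_bound].
(* The variance formula holds from n = 4 on, that is [m >= 2]. *)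
near=> m; have m2 : (2 <= m)%N by near: m; exact: nbhs_infty_ge.
apply/andP; split.
  apply: (@le_trans _ _ (coef_cdf_dist (desD_poly R (even_signed_parity m.+2 c)) 0)%:E).
    by rewrite lee_fin normr_ge0.
  by apply: ereal_sup_ubound; exists 0.
apply: ge_ereal_sup => _ [y _ <-]; rewrite lee_fin coef_cdf_dist_desD.
rewrite unif_var_desD// mean_desD.
exact: kolmogorov_desD.
Unshelve. all: by end_near. Qed.

End asymptotics.

Lemma Dplus_parity n : Dplus n = even_signed_parity n false.
Proof. by apply/setP => s; rewrite !inE eqbF_neg. Qed.

Lemma Dminus_parity n : Dminus n = even_signed_parity n true.
Proof. by apply/setP => s; rewrite !inE eqb_id. Qed.

(* The sequences of polynomials are indexed by m = n - 2, since n >= 2. *)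
Theorem theorem4p3 (R : realType) :
  [/\ asymptotically_normal (fun m : nat => desD_poly R (Dplus m.+2)),
      asymptotically_normal (fun m : nat => desD_poly R (Dminus m.+2)),
      forall n : nat, (3 <= n)%N ->
        unif_mean (Dplus n) (fun s => (desD s)%:R : R) = n%:R / 2%:R /\
        unif_mean (Dminus n) (fun s => (desD s)%:R : R) = n%:R / 2%:R
    & forall n : nat, (4 <= n)%N ->
        unif_var (Dplus n) (fun s => (desD s)%:R : R) = (n + 2)%:R / 12%:R /\
        unif_var (Dminus n) (fun s => (desD s)%:R : R) = (n + 2)%:R / 12%:R].
Proof.
split.
- under eq_fun do rewrite Dplus_parity.
  exact: asymptotically_normal_desD.
- under eq_fun do rewrite Dminus_parity.
  exact: asymptotically_normal_desD.
- by case=> [|[|n]]// _; rewrite Dplus_parity Dminus_parity !mean_desD.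
- by case=> [|[|n]]// n4; rewrite Dplus_parity Dminus_parity !unif_var_desD.
Qed.
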